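(* Let $\mathcal{X}=[0,1]^d$, let $P,Q\in\mathcal{P}(\mathcal{X})$, let $c\ge 0$, and for $k\in\mathbb{N}$ let $\mathcal{G}_k^*(c):=\mathcal{G}_k\big(\sqrt{k}\log k,\,2k^{-1}c,\,c\big)$. (1) Given $\tilde f:\mathcal{X}\to\mathbb{R}$ with $c_B^\star(\tilde f)\le c$, there exists $g\in\mathcal{G}_k^*(c)$ satisfying $$\|\tilde f-g\|_{\infty,P,Q}=O\big(k^{-1/2}\big);$$ explicitly, the right-hand side is $\big((\hat c_d+2)c+2\big)k^{-1/2}$, i.e. $\|\tilde f-g\|_{\infty,P,Q}\le \big((\hat c_d+2)c+2\big)k^{-1/2}$, where $\hat c_d$ is a constant depending only on $d$. (2) Moreover, for any $\mathbf{a}\in\mathbb{R}^3_{\ge 0}$, $c>0$ and $\epsilon>0$, there exists $\tilde f:\mathcal{X}\to\mathbb{R}$ with $c_B^\star(\tilde f)\le c$ such that $$\inf_{g\in\mathcal{G}_k(\mathbf{a})}\|\tilde f-g\|_{2}=\Omega\Big(k^{-\left(\frac12+\frac1d+\epsilon\right)}\Big).$$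
   Context: $\mathcal{P}(\mathcal{X})$ is the set of Borel probability measures on $\mathcal{X}$. All functions are Borel. Neural network class: let $\phi(x)=\frac{1}{1+e^{-x}}$ (logistic sigmoid). For $k\in\mathbb{N}$ and $\mathbf{a}=(a_1,a_2,a_3)\in\mathbb{R}^3_{\ge0}$, $\mathcal{G}_k(\mathbf{a})$ (also written $\mathcal{G}_k(a_1,a_2,a_3)$) is the set of functions $g:\mathbb{R}^d\to\mathbb{R}$ of the form $g(x)=\sum_{i=1}^k\beta_i\phi(w_i\cdot x+b_i)+b_0$ with $w_i\in\mathbb{R}^d$, $b_0,b_i,\beta_i\in\mathbb{R}$, $\max_{i=1,\dots,k,\,j=1,\dots,d}\{|w_{i,j}|,|b_i|\}\le a_1$, $|\beta_i|\le a_2$ for $i=1,\dots,k$, and $|b_0|\le a_3$. Barron class: for $f:\mathbb{R}^d\to\mathbb{R}$ having a Fourier representation $f(x)=\int_{\mathbb{R}^d}e^{i\omega\cdot x}\tilde F(d\omega)$, with $\tilde F$ a complex Borel measure on $\mathbb{R}^d$ with magnitude $F$, set $B(f):=\int_{\mathbb{R}^d}\sup_{x\in\mathcal{X}}|\omega\cdot x|\,F(d\omega)$. For $c\ge0$, $\mathcal{B}_c$ is the set of such $f$ with $B(f)\vee|f(0)|\le c$. For $\tilde f:\mathcal{X}\to\mathbb{R}$, $c_B^\star(\tilde f):=\inf\{c:\exists f\in\mathcal{B}_c,\ \tilde f=f|_{\mathcal{X}}\}$ (with $\inf\emptyset=\infty$). Norms: $\|f-g\|_{\infty,P,Q}:=\operatorname{ess\,sup}_P|f-g|\vee\operatorname{ess\,sup}_Q|f-g|$,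 where $\operatorname{ess\,sup}_P$ is the essential supremum with respect to $P$; $\|\cdot\|_2$ is the $L^2(\mathcal{X})$ norm with respect to Lebesgue measure. $a\vee b=\max\{a,b\}$. The asymptotic notation is in $k$; in (2) the constant implied by $\Omega$ may depend on $d$ and $\epsilon$. *)

(* Defs.v *)
From HB Require Import structures.
From mathcomp Require Import all_boot all_order all_algebra.
From mathcomp Require Import all_classical all_reals all_analysis.
From mathcomp Require Import ess_sup_inf hoelder.

Set Implicit Arguments.
Unset Strict Implicit.
Unset Printing Implicit Defensive.

Import Order.TTheory GRing.Theory Num.Theory.
Import numFieldNormedType.Exports.

Local Open Scope classical_set_scope.
Local Open Scope ring_scope.

(* R^d; the product sigma-algebra carried by tuples is the Borel one. *)
Notation euclid R d := (d.-tuple (measurableTypeR R)).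

Section euclidean_space.
Context {R : realType}.

Definition dot (d : nat) (u v : euclid R d) : R :=
  \sum_(j < d) (tnth u j : R) * tnth v j.

Definition origin (d : nat) : euclid R d := [tuple (0 : R) | _ < d].

Definition unit_cube (d : nat) : set (euclid R d) :=
  [set x | forall j, 0 <= (tnth x j : R) <= 1].

Lemma measurable_unit_cube (d : nat) : measurable (@unit_cube d).
Proof.
have -> : @unit_cube d = \big[setI/setT]_(j < d)
    ((fun x : euclid R d => tnth x j : measurableTypeR R) @^-1` `[0, 1]).
  rewrite -bigcap_seq; apply/seteqP; split=> x /= hx j.
    by move=> _ /=; rewrite in_itv/=; exact: hx.
  by have := hx j (mem_index_enum _); rewrite /= in_itv.
apply: bigsetI_measurable => j _; rewrite -[X in measurable X]setTI.
have h := @measurable_tnth _ (measurableTypeR R) d j.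
by apply: h => //; exact: measurable_itv.
Qed.

Definition cons_pair (d : nat) (p : euclid R d * measurableTypeR R) :
  euclid R d.+1 := [tuple of p.2 :: p.1].

Lemma measurable_cons_pair (d : nat) : measurable_fun setT (@cons_pair d).
Proof. exact: measurable_cons. Qed.

(* Lebesgue measure on R^d: the image of the product of the Lebesgue measures
   on R^(d-1) and R. *)
Definition lebesgue_cons (d : nat) (mu : {measure set (euclid R d) -> \bar R}) :
    set (euclid R d.+1) -> \bar R :=
  pushforward (mu \x @lebesgue_measure R)%E (@cons_pair d).

Section lebesgue_cons_measure.
Variables (d : nat) (mu : {measure set (euclid R d) -> \bar R}).

Let lebesgue_cons0 : lebesgue_cons mu set0 = 0%E.
Proof. by rewrite /lebesgue_cons /pushforward preimage_set0 measure0. Qed.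

Let lebesgue_cons_ge0 A : (0 <= lebesgue_cons mu A)%E.
Proof. by rewrite /lebesgue_cons /pushforward. Qed.

Let lebesgue_cons_sigma_additive : semi_sigma_additive (lebesgue_cons mu).
Proof.
move=> F mF tF mUF; have mcp := @measurable_cons_pair d.
have mpre A : measurable A -> measurable (@cons_pair d @^-1` A).
  by move=> mA; rewrite -[X in measurable X]setTI; exact: mcp.
rewrite /lebesgue_cons /pushforward preimage_bigcup.
apply: measure_semi_sigma_additive => [n||].
- exact: mpre.
- apply/trivIsetP => /= i j _ _ ij; rewrite -preimage_setI.
  by move/trivIsetP : tF => /(_ _ _ _ _ ij) ->//; rewrite preimage_set0.
- by rewrite -preimage_bigcup; exact: mpre.
Qed.

HB.instance Definition _ := isMeasure.Build _ _ _ (lebesgue_cons mu)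
  lebesgue_cons0 lebesgue_cons_ge0 lebesgue_cons_sigma_additive.

End lebesgue_cons_measure.

Fixpoint lebesgue_euclid (d : nat) : {measure set (euclid R d) -> \bar R} :=
  match d with
  | 0 => \d_([tuple] : euclid R 0)
  | d'.+1 => lebesgue_cons (lebesgue_euclid d')
  end.

End euclidean_space.
Arguments unit_cube {R} d.
Arguments origin {R} d.

Section complex_measures.
Context {dT} {T : measurableType dT} {R : realType}.
Implicit Types (nu : {charge set T -> \bar R}) (g : T -> R).

(* Integral of g against a charge, through the Jordan decomposition; it does
   not depend on the chosen Hahn decomposition. *)
Definition charge_integral nu g : R :=
  let P := projT1 (cid (Hahn_decomposition nu)) in
  let PN := projT2 (cid (Hahn_decomposition nu)) in
  let nuPN := projT2 (cid PN) in
  \int[jordan_pos nuPN]_x g x - \int[jordan_neg nuPN]_x g x.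

(* Charges being finite, a complex measure is the pair of its real and
   imaginary parts. *)
Record complex_measure := ComplexMeasure {
  re_part : {charge set T -> \bar R} ;
  im_part : {charge set T -> \bar R} }.

Definition cmodulus (nu : complex_measure) (A : set T) : R :=
  Num.sqrt (fine (re_part nu A) ^+ 2 + fine (im_part nu A) ^+ 2).

(* |nu|(A) is the supremum of sum_n |nu(E n)| over the countable measurable
   partitions of A. *)
Definition total_variation (nu : complex_measure) (A : set T) : \bar R :=
  ereal_sup [set (\sum_(0 <= n <oo) (cmodulus nu (E n))%:E)%E | E in
    [set E : (set T)^nat | [/\ forall n, measurable (E n),
                               trivIset setT E & \bigcup_n E n = A]]].

Definition is_magnitude (nu : complex_measure)
    (F : {finite_measure set T -> \bar R}) : Prop :=
  forall A, measurable A -> F A = total_variation nu A.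

End complex_measures.
Arguments complex_measure {dT} T R.

Section barron.
Context {R : realType} {d : nat}.
Implicit Types (f g : euclid R d -> R).

(* The real and imaginary parts of
   f(x) = \int (cos (w . x) + i sin (w . x)) (re + i im)(dw). *)
Definition fourier_representation f (nu : complex_measure (euclid R d) R) :=
  forall x,
    f x = charge_integral (re_part nu) (fun w => cos (dot w x))
        - charge_integral (im_part nu) (fun w => sin (dot w x)) /\
    0 = charge_integral (re_part nu) (fun w => sin (dot w x))
      + charge_integral (im_part nu) (fun w => cos (dot w x)).

Definition dual_norm (w : euclid R d) : \bar R :=
  ereal_sup [set `|dot w x|%:E | x in unit_cube d].

(* The measure nu, hence also its magnitude F, is determined by f. *)
Definition barron_class (c : R) : set (euclid R d -> R) :=
  [set f | exists (nu : complex_measure (euclid R d) R)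
                  (F : {finite_measure set (euclid R d) -> \bar R}),
    [/\ fourier_representation f nu, is_magnitude nu F &
        (maxe (\int[F]_w dual_norm w) `|f (origin d)|%:E <= c%:E)%E]].

(* Functions on the cube are encoded by functions on R^d whose values outside
   the cube are irrelevant. *)
Definition barron_const f : \bar R :=
  ereal_inf [set c%:E | c in [set c : R | 0 <= c /\
    exists2 h, barron_class c h & {in unit_cube d, f =1 h}]].

End barron.

Section networks.
Context {R : realType} {d : nat}.

Definition logistic (x : R) : R := (1 + expR (- x))^-1.

Definition shallow_nets (k : nat) (a1 a2 a3 : R) : set (euclid R d -> R) :=
  [set g | exists (beta : 'I_k -> R) (w : 'I_k -> euclid R d) (b : 'I_k -> R)
                  (b0 : R),
    [/\ forall x, g x = \sum_(i < k) beta i * logistic (dot (w i) x + b i) + b0,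
        forall i, (forall j, `|tnth (w i) j : R| <= a1) /\ `|b i| <= a1,
        forall i, `|beta i| <= a2 &
        `|b0| <= a3]].

Definition shallow_nets_star (k : nat) (c : R) : set (euclid R d -> R) :=
  shallow_nets k (Num.sqrt k%:R * ln k%:R) (2 * k%:R^-1 * c) c.

End networks.

Section norms.
Context {R : realType} {d : nat}.
Implicit Types (h : euclid R d -> R).

Definition sup_norm2 (P Q : {measure set (euclid R d) -> \bar R}) h : \bar R :=
  maxe (ess_sup P (fun x => `|h x|%:E)) (ess_sup Q (fun x => `|h x|%:E)).

Definition L2_norm_cube h : \bar R :=
  Lnorm (mrestr (@lebesgue_euclid R d) (@measurable_unit_cube R d)) 2%:E
    (EFin \o h).

End norms.

(* Main.v *)
(* Upper bound. Discretizing the Fourier measure turns f into f(0) plus a finite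
   sum of ridge functions of directions a with |a . x| <= 1 on the cube. Each is an
   average, over thresholds t spread evenly in [-1, 1], of steps 1_{a . x > t},
   which logistic units of slope sqrt k log k approximate within O(k^(-1/2)) in mean
   over t. One then picks k units, stratifying directions and thresholds into about
   sqrt k cells: at a given x only the few cells crossed by {a . x = t} contribute to the
   variance, so it is smaller than 1/k by a power of k. This gain absorbs the
   logarithm of the union bound over a polynomial grid of points x, and no VC or
   chaining argument is needed.

   Lower bound. The weights are bounded independently of k, so along the first
   axis the networks are uniformly analytic: their n-th differences at step h are
   at most k a_2 as soon as 2 a_1 n h <= 1. For f = sum_m 2 a 16^(-m) cos(pi 4^m x_1)
   and h = 4^(-M), the term m = M is multiplied by 2^n, the later ones vanish, and
   the earlier ones do not grow. Hence f - g cannot be small near all translates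
   t + j h, and with n of order a small power of k the L2 distance is at least a
   constant times n^(-3), which exceeds k^(-1/2). *)

Require Import Defs.
From HB Require Import structures.
From mathcomp Require Import all_boot all_order all_algebra.
From mathcomp Require Import all_classical all_reals all_analysis.
From mathcomp Require Import ess_sup_inf hoelder measurable_realfun.
From mathcomp Require Import lra ring zify.

Set Implicit Arguments.
Unset Strict Implicit.
Unset Printing Implicit Defensive.

Import Order.TTheory GRing.Theory Num.Theory.
Import numFieldNormedType.Exports.

Local Open Scope classical_set_scope.
Local Open Scope ring_scope.

(** The class bounds every |beta_i| by 2 c / k, so all selected units carry the same weight W / k up
    to sign, with W = 2 c; the 2 pays for the two signs of each direction, each with its own
    thresholds in [0, 1]. Equal weights force integer counts per stratum, and rounding costs up to W
    / k in each: hence only about sqrt k strata. The random draw is replaced by a greedy choice that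
    keeps a sum of exponential moments over the grid below its average. The infimum defining the
    Barron constant need not be attained and discretization adds to it, whereas the bounds on the
    weights are exact in c; a rescaling by c / (c + delta), with delta of order k^(-1/2), repairs
    this. In the lower bound, h = 4^(-M) is half a period of one term and a whole number of periods
    of the later ones, and 16^(-m) keeps the sum of amplitude times frequency finite. As h is of
    order 1 / n, the amplitude 16^(-M) = h^2 gives n^(-2), and the length h / n on which a gap is
    guaranteed gives, after a square root, the last n^(-1). *)

(** * Stratified sampling *)

(** The linear term stays outside the exponential so that it cancels when averaged over a centred
    stratum. The bound goes through 1 / (1 - y) <= 1 + y + 2 y^2, which holds for y <= 1/2. *)
Lemma expR_le_quadratic (R : realType) (y : R) :
  y <= 2^-1 -> expR y <= y + expR (2 * y ^+ 2).
Proof.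
move=> y2; have h1 : 1 - y <= expR (- y) by exact: expR_ge1Dx.
have h2 : 1 + 2 * y ^+ 2 <= expR (2 * y ^+ 2) by exact: expR_ge1Dx.
apply: (@le_trans _ _ (1 + y + 2 * y ^+ 2)); last by lra.
rewrite -[y in expR y]opprK expRN -[leLHS]div1r ler_pdivrMr ?expR_gt0//.
have h3 : 0 <= 1 + y + 2 * y ^+ 2 by nra.
apply: le_trans (_ : (1 + y + 2 * y ^+ 2) * (1 - y) <= _); last exact: ler_wpM2l.
have : 0 <= y ^+ 2 * (1 - 2 * y) by rewrite mulr_ge0 ?sqr_ge0//; lra.
by nra.
Qed.

Lemma le_weighted_exists (R : realType) (P : finType) (A : pred P)
    (mu F : P -> R) (b : R) :
  (forall p, 0 <= mu p) -> 0 < \sum_(p | A p) mu p ->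
  \sum_(p | A p) mu p * F p <= (\sum_(p | A p) mu p) * b ->
  exists2 p, A p & F p <= b.
Proof.
move=> mu0 mu1 h; apply: contrapT => nex.
have bF p : A p -> b < F p.
  by move=> Ap; rewrite ltNge; apply/negP => Fb; apply: nex; exists p.
have le p : A p -> mu p * b <= mu p * F p by move=> /bF /ltW; exact: ler_wpM2l.
have : \sum_(p | A p) mu p * (F p - b) <= 0.
  under eq_bigr do rewrite mulrBr.
  by rewrite sumrB -mulr_suml subr_le0.
move=> h1; have ge0 p : A p -> 0 <= mu p * (F p - b).
  by move=> Ap; rewrite mulr_ge0// subr_ge0 ltW// bF.
have /eqP : \sum_(p | A p) mu p * (F p - b) = 0.
  by apply/eqP; rewrite eq_le h1/= sumr_ge0.
rewrite psumr_eq0// => /allP h2.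
have : \sum_(p | A p) mu p = 0.
  apply: big1 => p Ap; have := h2 p (mem_index_enum _).
  by rewrite Ap/= mulf_eq0 subr_eq0 (gt_eqF (bF _ Ap)) orbF => /eqP.
by move=> h3; rewrite h3 ltxx in mu1.
Qed.

(* Greedy choice of one element per stratum of [s]: at each step some element
   does at least as well as the average over its stratum. *)
Lemma exp_moment_selection (R : realType) (P K Z : finType) (mu : P -> R)
    (key : P -> K) (D : P -> Z -> R) (B : K -> Z -> R) (lam : R) :
  (forall p, 0 <= mu p) ->
  (forall i z, \sum_(p | key p == i) mu p * D p z = 0) ->
  (forall p z, `|D p z| <= B (key p) z) ->
  (forall p z, lam * D p z <= 2^-1) ->
  forall (s : seq K) (w : Z -> R),
    (forall i, i \in s -> 0 < \sum_(p | key p == i) mu p) ->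
    (forall z, 0 <= w z) ->
  exists2 t : seq P, map key t = s &
    \sum_z w z * expR (lam * \sum_(p <- t) D p z) <=
    \sum_z w z * expR (2 * lam ^+ 2 * \sum_(i <- s) B i z ^+ 2).
Proof.
move=> mu0 cent DB lamD; elim=> [w _ w0|i s IH w s0 w0].
  by exists [::] => //; apply: ler_sum => z _; rewrite !big_nil !mulr0.
(* The strata still to come enter through their final bound [E], so that the pick for [i] can be
   made first; the induction hypothesis is then applied with weights updated by this pick. *)
pose E z := expR (2 * lam ^+ 2 * \sum_(i <- s) B i z ^+ 2).
have [p /eqP pi hp] : exists2 p, key p == i &
    \sum_z w z * E z * expR (lam * D p z) <=
    \sum_z w z * E z * expR (2 * lam ^+ 2 * B i z ^+ 2).
  apply: (le_weighted_exists mu0); first by apply: s0; rewrite mem_head.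
  under eq_bigr do rewrite mulr_sumr.
  rewrite exchange_big mulr_sumr; apply: ler_sum => z _ /=.
  under eq_bigr do rewrite mulrCA.
  rewrite -mulr_sumr mulrCA ler_wpM2l ?mulr_ge0 ?w0 ?expR_ge0//.
  apply: (@le_trans _ _ (\sum_(p | key p == i)
     (lam * (mu p * D p z) + mu p * expR (2 * lam ^+ 2 * B i z ^+ 2)))).
    apply: ler_sum => p /eqP pi; rewrite mulrCA -mulrDr ler_wpM2l//.
    apply: le_trans (expR_le_quadratic (lamD p z)) _.
    rewrite lerD2l ler_expR -mulrA exprMn !ler_wpM2l ?sqr_ge0//.
    by rewrite -(real_normK (num_real (D p z))) -pi lerXn2r// nnegrE (le_trans _ (DB _ _)).
  by rewrite big_split/= -mulr_sumr cent mulr0 add0r mulr_suml.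
have [|z|t ts ht] := IH (fun z => w z * expR (lam * D p z)).
- by move=> j js; apply: s0; rewrite inE js orbT.
- by rewrite mulr_ge0 ?expR_ge0.
exists (p :: t) => /=; first by rewrite pi ts.
apply: le_trans (_ : \sum_z w z * expR (lam * D p z) *
          expR (lam * \sum_(p <- t) D p z) <= _).
  by apply: ler_sum => z _; rewrite big_cons mulrDr expRD mulrA.
apply: le_trans ht _.
have -> : \sum_z w z * expR (lam * D p z) *
    expR (2 * lam ^+ 2 * \sum_(i <- s) B i z ^+ 2) =
    \sum_z w z * E z * expR (lam * D p z).
  by apply: eq_bigr => z _; rewrite mulrAC.
apply: le_trans hp _; apply: ler_sum => z _.
by rewrite big_cons mulrDr expRD -mulrA [E z * _]mulrC.
Qed.

(* A stratum of mass m receives floor(k m / W) samples of weight W / k. The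
   rounding costs at most W / k per stratum, and only the oscillation inside the
   strata contributes to the random error. *)
Lemma stratified_sampling (R : realType) (P K X : finType) (mu : P -> R)
    (y : P -> X -> R) (key : P -> K) (osc : K -> X -> R) (W v lam T : R)
    (k : nat) :
  (forall p, 0 <= mu p) -> \sum_p mu p <= W -> 0 < W ->
  (forall p x, `|y p x| <= 1) ->
  (forall p q x, key p = key q -> `|y p x - y q x| <= osc (key p) x) ->
  (forall x, \sum_p mu p * osc (key p) x ^+ 2 <= W * v) ->
  0 <= lam <= 4^-1 ->
  (#|X| * 2)%:R * expR (2 * lam ^+ 2 * (k%:R * v)) < expR (lam * T) ->
  (0 < k)%N ->
  exists2 t : seq P, (size t <= k)%N &
    forall x, `|\sum_p mu p * y p x - W / k%:R * \sum_(p <- t) y p x|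
              <= W / k%:R * (#|K|%:R + T).
Proof.
move=> mu0 muW W0 y1 yosc var /andP[lam0 lam4] hT k0.
have kR0 : 0 < k%:R :> R by rewrite ltr0n.
pose mass i := \sum_(p | key p == i) mu p.
have mass0 i : 0 <= mass i by exact: sumr_ge0.
pose mean i x := (\sum_(p | key p == i) mu p * y p x) / mass i.
have massmean i x : mass i * mean i x = \sum_(p | key p == i) mu p * y p x.
  have [mi|mi] := eqVneq (mass i) 0; last by rewrite mulrCA mulfV ?mulr1.
  rewrite mi mul0r; apply/esym/big1 => p kp.
  have /eqP := mi; rewrite psumr_eq0// => /allP/(_ p (mem_index_enum _)).
  by rewrite kp/= => /eqP ->; rewrite mul0r.
have mean1 i x : `|mean i x| <= 1.
  have [mi|mi] := eqVneq (mass i) 0.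
    by rewrite /mean mi invr0 mulr0 normr0.
  have mi0 : 0 < mass i by rewrite lt_neqAle eq_sym mi mass0.
  rewrite /mean normrM normfV (gtr0_norm mi0) ler_pdivrMr// mul1r.
  apply: le_trans (ler_norm_sum _ _ _) _; apply: ler_sum => p _.
  by rewrite normrM ger0_norm// ler_piMr.
have ymean p x : mass (key p) != 0 -> `|y p x - mean (key p) x| <= osc (key p) x.
  move=> mi; have mi0 : 0 < mass (key p) by rewrite lt_neqAle eq_sym mi mass0.
  rewrite -(ler_pM2l mi0) -{1}(gtr0_norm mi0) -normrM mulrBr massmean.
  rewrite /mass !mulr_suml -sumrB; apply: le_trans (ler_norm_sum _ _ _) _.
  apply: ler_sum => q /eqP qp; rewrite -mulrBr normrM ger0_norm// ler_wpM2l//.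
  exact: yosc.
(* The boolean is a sign, so that upper bounds for all [z] give two-sided bounds. Null strata are
   never sampled; [D] is set to 0 there because the oscillation bound would fail. *)
pose D p (z : X * bool) :=
  if mass (key p) == 0 then 0 else (-1) ^+ z.2 * (y p z.1 - mean (key p) z.1).
pose n i := Num.truncn (k%:R * mass i / W).
have nle i : (n i)%:R <= k%:R * mass i / W.
  by rewrite truncn_le// divr_ge0 ?mulr_ge0// ltW.
pose s := flatten [seq nseq (n i) i | i <- enum K].
have sumsE (F : K -> R) : \sum_(i <- s) F i = \sum_i (n i)%:R * F i.
  rewrite big_flatten big_map big_enum /=; apply: eq_bigr => i _.
  by rewrite big_nseq -Monoid.iteropE /= mulr_natl.
have sizes : (size s <= k)%N.
  rewrite -(ler_nat R) -sum1_size natr_sum sumsE.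
  apply: le_trans (_ : \sum_i k%:R * mass i / W <= _).
    by apply: ler_sum => i _; rewrite mulr1.
  rewrite -mulr_suml -mulr_sumr -mulrA ger_pMr// ler_pdivrMr// mul1r.
  by apply: le_trans muW; rewrite [leRHS](partition_big key predT).
have spos i : i \in s -> 0 < mass i.
  case/flattenP => u /mapP[j _ ->]; rewrite mem_nseq => /andP[nj /eqP ->].
  rewrite lt_neqAle mass0 andbT; apply/eqP => mj; move: nj.
  by rewrite /n -mj mulr0 mul0r truncn0.
have osc0 p x : 0 <= osc (key p) x by exact: le_trans (yosc p p x erefl).
pose oscz i (z : X * bool) := osc i z.1.
have DB p z : `|D p z| <= oscz (key p) z.
  rewrite /D /oscz; case: eqP => [_|/eqP mi]; first by rewrite normr0 osc0.
  by rewrite normrM normrX normrN1 expr1n mul1r ymean.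
have [||t ts ht] := exp_moment_selection (B := oscz) (lam := lam) mu0 _ DB _ spos
    (fun z : X * bool => ler01 : 0 <= 1 :> R).
- move=> i [x b]; have [mi|mi] := eqVneq (mass i) 0.
    by apply: big1 => p /eqP kp; rewrite /D kp mi eqxx mulr0.
  under eq_bigr => p /eqP kp do rewrite /D kp (negbTE mi) /= mulrCA mulrBr.
  by rewrite -mulr_sumr sumrB -massmean mulr_suml subrr mulr0.
- move=> p z; rewrite /D; case: eqP => [_|/eqP mi]; first by rewrite mulr0.
  apply: le_trans (ler_norm _) _; rewrite !normrM normrX normrN1 expr1n mul1r.
  have h : `|y p z.1 - mean (key p) z.1| <= 2.
    by apply: le_trans (ler_normB _ _) _; rewrite [leRHS]mulr2n lerD.
  rewrite ger0_norm//; apply: le_trans (_ : 4^-1 * 2 <= _); last lra.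
  exact: ler_pM.
have varle (z : X * bool) : \sum_(i <- s) osc i z.1 ^+ 2 <= k%:R * v.
  rewrite sumsE; apply: le_trans (_ : \sum_i (k%:R * mass i / W) * osc i z.1 ^+ 2 <= _).
    by apply: ler_sum => i _; rewrite ler_wpM2r ?sqr_ge0.
  apply: le_trans (_ : k%:R / W * (W * v) <= _); last first.
    by rewrite mulrA divfK// gt_eqF.
  apply: le_trans (_ : k%:R / W * (\sum_p mu p * osc (key p) z.1 ^+ 2) <= _); last first.
    by rewrite ler_wpM2l ?var// divr_ge0// ltW.
  rewrite (partition_big key predT)//= mulr_sumr; apply: ler_sum => i _.
  rewrite (_ : k%:R * mass i / W * osc i z.1 ^+ 2 =
    k%:R / W * (mass i * osc i z.1 ^+ 2)); last by ring.
  rewrite ler_wpM2l ?divr_ge0 ?(ltW W0)// /mass mulr_suml.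
  by apply: ler_sum => p /eqP ->.
have tot : \sum_(z : X * bool) 1 * expR (lam * \sum_(p <- t) D p z) < expR (lam * T).
  apply: le_lt_trans ht _; apply: le_lt_trans hT.
  rewrite [leRHS](_ : _ = \sum_(z : X * bool) expR (2 * lam ^+ 2 * (k%:R * v))).
    apply: ler_sum => z _.
    by rewrite mul1r ler_expR ler_wpM2l ?mulr_ge0 ?sqr_ge0 ?varle.
  by rewrite sumr_const card_prod card_bool mulr_natl.
(* A single deviation above [T] would already exceed the whole sum of exponentials. *)
have ST z : \sum_(p <- t) D p z <= T.
  rewrite leNgt; apply/negP => /ltW hTz; move: tot; apply/negP; rewrite -leNgt.
  rewrite (bigD1 z)//= mul1r; apply: le_trans (_ : expR (lam * \sum_(p <- t) D p z) <= _).
    by rewrite ler_expR ler_wpM2l.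
  by rewrite lerDl sumr_ge0// => i _; rewrite mulr_ge0// expR_ge0.
exists t; first by rewrite -(size_map key) ts.
move=> x.
have Dt (b : bool) : \sum_(p <- t) D p (x, b) =
    (-1) ^+ b * (\sum_(p <- t) y p x - \sum_(i <- s) mean i x).
  rewrite -ts big_map -sumrB mulr_sumr; apply: eq_big_seq => p pt.
  have /spos : key p \in s by rewrite -ts map_f.
  by rewrite /D => /gt_eqF ->.
have devT : `|\sum_(p <- t) y p x - \sum_(i <- s) mean i x| <= T.
  rewrite ler_norml; have := ST (x, false); have := ST (x, true).
  by rewrite !Dt /= expr1 expr0 mul1r mulN1r => h ->; rewrite andbT lerNl.
rewrite (partition_big key predT)//=.
under eq_bigr do rewrite -massmean.
set S := \sum_(p <- t) _ in devT *.
(* Rounding error of the counts, plus deviation of the sample from its stratum means. *)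
rewrite (_ : \sum_i _ - _ = \sum_i (mass i - W / k%:R * (n i)%:R) * mean i x
    - W / k%:R * (S - \sum_(i <- s) mean i x)); last first.
  have -> : \sum_i (mass i - W / k%:R * (n i)%:R) * mean i x =
      \sum_i mass i * mean i x - W / k%:R * \sum_(i <- s) mean i x.
    by rewrite sumsE mulr_sumr -sumrB; apply: eq_bigr => i _; ring.
  by ring.
apply: le_trans (ler_normB _ _) _; rewrite [leRHS]mulrDr lerD//; last first.
  by rewrite normrM ger0_norm ?ler_wpM2l ?divr_ge0// ltW.
apply: le_trans (ler_norm_sum _ _ _) _.
rewrite [leRHS](_ : _ = \sum_(i : K) (W / k%:R)); last by rewrite sumr_const mulr_natr.
apply: ler_sum => i _.
rewrite normrM -[leRHS]mulr1 ler_pM//.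
have := truncn_itv (x := k%:R * mass i / W).
move=> /(_ (divr_ge0 (mulr_ge0 (ltW kR0) (mass0 i)) (ltW W0))) /andP[h1 h2].
rewrite -/(n i) in h1 h2.
have e : mass i = W / k%:R * (k%:R * mass i / W).
  by field; rewrite !gt_eqF.
have Wk0 : 0 <= W / k%:R by rewrite divr_ge0// ltW.
rewrite {1}e -mulrBr normrM ger0_norm// ler_piMr//.
rewrite ger0_norm ?subr_ge0// lerBlDr.
by rewrite -natr1 addrC in h2; exact: ltW.
Qed.

(** * Ridge functions as combinations of logistic units *)

Section trigonometric_bounds.
Context {R : realType}.
Implicit Types x y s t : R.

Lemma norm_sin_le x : `|sin x| <= `|x|.
Proof.
suff H y : 0 <= y -> `|sin y| <= y.
  have [x0|x0] := leP 0 x; first by rewrite (ger0_norm x0) H.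
  by rewrite -normrN -sinN (ltr0_norm x0) H// oppr_ge0 ltW.
move=> y0; have [c _] := @MVT_segment R sin cos 0 y y0 (fun x _ => is_derive_sin x)
  (continuous_subspaceT (@continuous_sin R)).
rewrite sin0 !subr0 => ->; rewrite normrM (ger0_norm y0) ler_piMl//.
exact: cos_max.
Qed.

(** A product formula for the difference, then Cauchy-Schwarz against (sin m, cos m). The constant
    must be sqrt (a^2 + b^2), and not |a| + |b|, to match the modulus of a complex mass later on. *)
Lemma wave_lipschitz (a b N s t : R) :
  `|(a * cos (N * s) - b * sin (N * s)) - (a * cos (N * t) - b * sin (N * t))|
    <= Num.sqrt (a ^+ 2 + b ^+ 2) * `|N| * `|s - t|.
Proof.
pose m := N * (s + t) / 2; pose e := N * (s - t) / 2.
have -> : N * s = m + e by rewrite /m /e; field.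
have -> : N * t = m - e by rewrite /m /e; field.
rewrite cosD sinD cosB sinB.
rewrite (_ : _ - _ = - 2 * (a * sin m + b * cos m) * sin e); last by ring.
rewrite 2!normrM normrN (ger0_norm (ler0n R 2)).
have h1 : `|a * sin m + b * cos m| <= Num.sqrt (a ^+ 2 + b ^+ 2).
  rewrite -sqrtr_sqr ler_sqrt; last by rewrite addr_ge0 ?sqr_ge0.
  have := cos2Dsin2 m; set C := cos m; set S := sin m => h.
  have -> : a ^+ 2 + b ^+ 2 = (a ^+ 2 + b ^+ 2) * (C ^+ 2 + S ^+ 2) by rewrite h mulr1.
  rewrite -subr_ge0 (_ : _ - _ = (a * C - b * S) ^+ 2) ?sqr_ge0//; ring.
have h2 : `|sin e| <= `|N| * `|s - t| / 2.
  by apply: le_trans (norm_sin_le _) _; rewrite /e !normrM (ger0_norm (x := 2^-1)).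
apply: (@le_trans _ _ (2 * Num.sqrt (a ^+ 2 + b ^+ 2) * (`|N| * `|s - t| / 2))).
  by apply: ler_pM => //; apply: ler_wpM2l.
by rewrite le_eqVlt; apply/orP; left; apply/eqP; field.
Qed.

Lemma norm_cos_sub_le x y : `|cos x - cos y| <= `|x - y|.
Proof.
have := wave_lipschitz 1 0 1 x y.
by rewrite !mul0r !subr0 !mul1r expr1n expr0n/= addr0 sqrtr1 normr1 !mul1r.
Qed.

Lemma norm_sin_sub_le x y : `|sin x - sin y| <= `|x - y|.
Proof.
have := wave_lipschitz 0 1 1 x y.
rewrite !mul0r !sub0r !mul1r expr1n expr0n/= add0r sqrtr1 normr1 !mul1r.
by rewrite -opprD normrN.
Qed.

End trigonometric_bounds.

Section logistic_function.
Context {R : realType}.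
Implicit Types x y s t : R.

Lemma oneDexpN_gt0 x : 0 < 1 + expR (- x).
Proof. by rewrite addr_gt0// expR_gt0. Qed.

Lemma logistic_ge0 x : 0 <= logistic x.
Proof. by rewrite invr_ge0 ltW// oneDexpN_gt0. Qed.

Lemma logistic_le1 x : logistic x <= 1.
Proof. by rewrite invf_le1 ?oneDexpN_gt0// lerDl expR_ge0. Qed.

Lemma logistic_le x y : x <= y -> logistic x <= logistic y.
Proof.
by move=> xy; rewrite lef_pV2 ?posrE ?oneDexpN_gt0// lerD2l ler_expR lerN2.
Qed.

Lemma logistic_leexp x : logistic x <= expR x.
Proof.
rewrite -[expR x]invrK -expRN lef_pV2 ?posrE ?oneDexpN_gt0 ?expR_gt0//.
by rewrite lerDr.
Qed.

Lemma logisticN x : logistic (- x) = 1 - logistic x.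
Proof.
have e0 := expR_gt0 x; have h := oneDexpN_gt0 x.
rewrite /logistic opprK; move: h; rewrite expRN => h.
field; rewrite !gt_eqF// ?addr_gt0//.
Qed.

Lemma logistic_lipschitz x y : `|logistic x - logistic y| <= `|x - y|.
Proof.
wlog xy : x y / y <= x.
  move=> H; have [yx|/ltW xy] := leP y x; first exact: H.
  by rewrite distrC (distrC x); exact: H.
rewrite !ger0_norm ?subr_ge0 ?logistic_le//.
have h : 1 - (x - y) <= expR (- (x - y)) by exact: expR_ge1Dx.
have e : expR (- x) = expR (- y) * expR (- (x - y)) by rewrite -expRD; congr expR; ring.
rewrite /logistic e; set b := expR (- y); set q := expR (- (x - y)) in h *.
have b0 : 0 < b by exact: expR_gt0.
have q0 : 0 < q by exact: expR_gt0.
have bq0 : 0 < b * q by rewrite mulr_gt0.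
have q1 : q <= 1 by rewrite /q -expR0 ler_expR oppr_le0 subr_ge0.
apply: (@le_trans _ _ (1 - q)); last lra.
rewrite (_ : _ - _ = b * (1 - q) / ((1 + b * q) * (1 + b))); last first.
  by field; rewrite !gt_eqF// addr_gt0.
rewrite ler_pdivrMr; last by rewrite mulr_gt0 ?addr_gt0.
rewrite mulrC ler_wpM2l ?subr_ge0//; nra.
Qed.

End logistic_function.

Section ridge_functions.
Context {R : realType}.
Implicit Types (s tau K x : R).

(** With x = exp (- delta), x (1 + delta) <= 1 gives 1 / (1 - x) <= 1 + 1 / delta. *)
Lemma geometric_expR_le (n : nat) (delta : R) : 0 < delta ->
  \sum_(0 <= i < n) expR (- (delta * i%:R)) <= 1 + delta^-1.
Proof.
move=> d0; set x := expR (- delta).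
have x0 : 0 < x by exact: expR_gt0.
have xd : x * (1 + delta) <= 1.
  by rewrite /x expRN ler_pdivrMl ?expR_gt0// mulr1 expR_ge1Dx.
have x1 : 0 < 1 - x by nra.
under eq_bigr do rewrite -mulNr mulrC expRM_natl -/x.
have h : (1 - x) * \sum_(0 <= i < n) x ^+ i <= 1.
  by rewrite big_mkord -opprB mulNr -subrX1 opprB lerBlDr lerDl exprn_ge0// ltW.
rewrite -(ler_pM2l x1); apply: le_trans h _.
rewrite -(ler_pM2r d0) mul1r -mulrA (_ : (1 + delta^-1) * delta = delta + 1).
  by nra.
by field; rewrite gt_eqF.
Qed.

(** The index [q] is the rank of [s] among the thresholds. Moving away from it, on either side, the
    error gains a factor exp (- tau / M) per index: one geometric series per side. *)
Lemma logistic_steps_le (M q : nat) (tau s : R) : (0 < M)%N -> 0 < tau ->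
  (q <= M)%N ->
  (forall p, (p < q)%N -> p%:R / M%:R <= s) ->
  (forall p, (q <= p)%N -> s <= p%:R / M%:R) ->
  \sum_(0 <= p < M) `|(p < q)%N%:R - logistic (tau * (s - p%:R / M%:R))|
    <= 2 * (1 + M%:R / tau).
Proof.
move=> M0 tau0 qM hlt hge.
have M0' : 0 < M%:R :> R by rewrite ltr0n.
have d0 : 0 < tau / M%:R by rewrite divr_gt0.
rewrite (big_cat_nat (n := q))//= mulr_natl mulr2n.
have -> : M%:R / tau = (tau / M%:R)^-1 by rewrite invf_div.
apply: lerD.
  apply: le_trans (geometric_expR_le q d0).
  rewrite big_nat_rev /= add0n; apply: ler_sum_nat => p /andP[_ pq].
  have qp : (q - p.+1 < q)%N by rewrite ltn_subrL/= (leq_ltn_trans _ pq).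
  rewrite qp -logisticN ger0_norm ?logistic_ge0//.
  apply: le_trans (logistic_leexp _) _; rewrite ler_expR lerN2.
  rewrite mulrAC -mulrA ler_pM2l//.
  have := hlt q.-1; rewrite prednK ?(leq_ltn_trans _ pq)// => /(_ (leqnn _)).
  have <- : p%:R / M%:R + (q - p.+1)%:R / M%:R = q.-1%:R / M%:R :> R.
    by rewrite -mulrDl -natrD; congr (_%:R / _); lia.
  lra.
apply: le_trans (geometric_expR_le (M - q) d0).
rewrite -{1}[q]add0n big_addn; apply: ler_sum_nat => p _.
have -> : (p + q < q)%N = false by lia.
rewrite sub0r normrN ger0_norm ?logistic_ge0//.
apply: le_trans (logistic_leexp _) _; rewrite ler_expR.
have -> : - (tau / M%:R * p%:R) = tau * - (p%:R / M%:R) by ring.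
rewrite ler_pM2l// natrD mulrDl.
have := hge q (leqnn _); lra.
Qed.

(* Compare with the step functions [p/M < s], for which the sum telescopes; the
   logistic units differ from them by a geometric series in [p]. *)
Lemma ridge_half (h : R -> R) (K tau s : R) (M : nat) :
  0 <= K -> (forall u v, `|h u - h v| <= K * `|u - v|) ->
  0 < tau -> (0 < M)%N -> s <= 1 ->
  `|h (Num.max s 0) - h 0 - \sum_(p < M)
      (h (p.+1%:R / M%:R) - h (p%:R / M%:R)) * logistic (tau * (s - p%:R / M%:R))|
    <= K * (2 / tau + 3 / M%:R).
Proof.
move=> K0 hK tau0 M0 s1.
have M0' : 0 < M%:R :> R by rewrite ltr0n.
(* As [s <= 1], the index [M] qualifies. The least such index is 0 when [s <= 0], which agrees with
   [Num.max s 0]. *)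
have exq : exists p : nat, s <= p%:R / M%:R by exists M; rewrite divff// gt_eqF.
case: (ex_minnP exq) => q hq minq.
have qM : (q <= M)%N by apply: minq; rewrite divff// gt_eqF.
have hlt p : (p < q)%N -> p%:R / M%:R <= s.
  by rewrite ltnNge => pq; rewrite leNgt; apply: contra pq => /ltW/minq.
have hge p : (q <= p)%N -> s <= p%:R / M%:R.
  by move=> qp; apply: le_trans hq _; rewrite ler_pM2r ?invr_gt0// ler_nat.
have near : `|Num.max s 0 - q%:R / M%:R| <= M%:R^-1.
  have [s0|s0] := leP s 0.
    have -> : q = 0%N by apply/eqP; rewrite -leqn0 minq// mul0r.
    by rewrite mul0r subrr normr0 invr_ge0 ltW.
  case: q hlt {hge minq qM} hq => [_|q hlt hq].
    by rewrite mul0r leNgt s0.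
  have := hlt q (ltnSn _); move: hq; rewrite -natr1 mulrDl mul1r ler_norml.
  by move=> h1 h2; apply/andP; split; lra.
pose D p := h (p.+1%:R / M%:R) - h (p%:R / M%:R).
have DK p : `|D p| <= K / M%:R.
  apply: le_trans (hK _ _) _; rewrite -mulrBl -natrB// subSn// subnn mul1r.
  by rewrite ger0_norm// invr_ge0 ltW.
have tele : \sum_(0 <= p < M) D p * (p < q)%N%:R = h (q%:R / M%:R) - h 0.
  rewrite (big_cat_nat (n := q))//= [X in _ + X]big_nat [X in _ + X]big1; last first.
    by move=> p /andP[qp _]; rewrite ltnNge qp mulr0.
  rewrite addr0 big_nat; under eq_bigr => p /andP[_ pq] do rewrite pq mulr1.
  rewrite -big_nat (telescope_sumr (fun p => h (p%:R / M%:R)))//.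
  by rewrite mul0r.
rewrite -(big_mkord xpredT (fun p => D p * logistic (tau * (s - p%:R / M%:R)))).
rewrite (_ : _ - _ - _ = (h (Num.max s 0) - h (q%:R / M%:R)) +
   \sum_(0 <= p < M) D p * ((p < q)%N%:R - logistic (tau * (s - p%:R / M%:R)))); last first.
  under [in RHS]eq_bigr do rewrite mulrBr.
  rewrite sumrB tele; ring.
apply: le_trans (ler_normD _ _) _.
apply: (@le_trans _ _ (K * M%:R^-1 + K / M%:R * (2 * (1 + M%:R / tau)))); last first.
  rewrite le_eqVlt; apply/orP; left; apply/eqP; field.
  by rewrite !gt_eqF.
apply: lerD; first by apply: le_trans (hK _ _) _; rewrite ler_wpM2l.
apply: le_trans (ler_norm_sum _ _ _) _.
apply: le_trans (ler_wpM2l _ (logistic_steps_le M0 tau0 qM hlt hge)); last first.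
  by rewrite divr_ge0// ltW.
rewrite mulr_sumr; apply: ler_sum => p _.
by rewrite normrM ler_wpM2r.
Qed.

End ridge_functions.

(** * Networks approximating finite sums of waves *)

Section cube_norm.
Context {R : realType} {d : nat}.
Implicit Types (w x : euclid R d).

(** Closed form of the supremum of |w . x| over the cube, reached at the vertex that selects all
    positive or all negative coordinates; measurability in [w] becomes plain. *)
Definition cube_norm w : R :=
  Num.max (\sum_(j < d) Num.max (tnth w j : R) 0)
          (\sum_(j < d) Num.max (- (tnth w j : R)) 0).

Lemma dot_max_le w x : unit_cube d x -> dot w x <= \sum_(j < d) Num.max (tnth w j : R) 0.
Proof.
move=> cx; apply: ler_sum => j _; have /andP[x0 x1] := cx j.
rewrite le_max; have [w0|w0] := leP 0 (tnth w j : R).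
  by rewrite ler_piMr.
by rewrite orbC mulr_le0_ge0// ltW.
Qed.

Lemma dotN w x : dot [tuple - (tnth w j : R) | j < d] x = - dot w x.
Proof.
by rewrite /dot -sumrN; apply: eq_bigr => j _; rewrite tnth_mktuple mulNr.
Qed.

Lemma norm_dot_le w x : unit_cube d x -> `|dot w x| <= cube_norm w.
Proof.
move=> cx; rewrite ler_norml lerNl; apply/andP; split; last first.
  by rewrite le_max dot_max_le.
rewrite -dotN le_max; apply/orP; right; apply: le_trans (dot_max_le _ cx) _.
by apply: ler_sum => j _; rewrite tnth_mktuple.
Qed.

Lemma cube_norm_ge0 w : 0 <= cube_norm w.
Proof. by rewrite le_max sumr_ge0// => j _; rewrite le_max lexx orbT. Qed.

Lemma dual_normE w : dual_norm w = (cube_norm w)%:E.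
Proof.
apply/eqP; rewrite eq_le; apply/andP; split.
  by apply: ge_ereal_sup => _ [x cx <-]; rewrite lee_fin norm_dot_le.
suff att (e : bool) : ((\sum_(j < d) Num.max ((-1) ^+ e * (tnth w j : R)) 0)%:E <= dual_norm w)%E.
  have := att false; have := att true; rewrite /cube_norm EFin_max ge_max.
  rewrite /= expr1 expr0; under eq_bigr do rewrite mulN1r.
  by move=> ->; under eq_bigr do rewrite mul1r; move=> ->.
pose x : euclid R d := [tuple if 0 <= (-1) ^+ e * (tnth w j : R) then 1 else 0 | j < d].
have cx : unit_cube d x.
  by move=> j; rewrite tnth_mktuple; case: ifP; rewrite ?lexx ler01.
apply: le_trans (ereal_sup_ubound (_ : _ `|dot w x|%:E)); last by exists x.
rewrite lee_fin -[`|dot w x|](normrMsign e); apply: le_trans (ler_norm _).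
rewrite mulr_sumr; apply: ler_sum => j _; rewrite tnth_mktuple mulrA.
have [h|h] := leP 0; first by rewrite mulr1.
by rewrite mulr0.
Qed.

Lemma norm_tnth_le w j : `|tnth w j : R| <= cube_norm w.
Proof.
have le (u : euclid R d) : tnth u j <= \sum_(j < d) Num.max (tnth u j : R) 0.
  rewrite (bigD1 j)//= ler_wpDr ?le_max ?lexx// sumr_ge0// => i _.
  by rewrite le_max lexx orbT.
rewrite ler_norml lerNl; apply/andP; split; last by rewrite le_max le.
rewrite le_max; have := le [tuple - (tnth w j : R) | j < d].
rewrite tnth_mktuple => h; apply/orP; right; apply: le_trans h _.
by apply: ler_sum => i _; rewrite tnth_mktuple.
Qed.

Lemma cube_norm_le_dist w x :
  cube_norm w <= cube_norm x + \sum_(j < d) `|(tnth w j : R) - tnth x j|.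
Proof.
have h (a b : R) : Num.max a 0 <= Num.max b 0 + `|a - b|.
  have [ba|ab] := leP b a.
    rewrite ge_max; apply/andP; split; last by rewrite addr_ge0// le_max lexx orbT.
    rewrite ger0_norm ?subr_ge0// -lerBlDr opprB addrCA subrr addr0.
    by rewrite le_max lexx.
  rewrite ler_wpDr// ge_max !le_max (ltW ab) lexx orbT//.
rewrite /cube_norm ge_max; apply/andP; split.
  apply: (@le_trans _ _ (\sum_(j < d) Num.max (tnth x j : R) 0 +
      \sum_(j < d) `|(tnth w j : R) - tnth x j|)).
    by rewrite -big_split; apply: ler_sum => j _; exact: h.
  by rewrite lerD2r le_max lexx.
apply: (@le_trans _ _ (\sum_(j < d) Num.max (- (tnth x j : R)) 0 +
      \sum_(j < d) `|(tnth w j : R) - tnth x j|)).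
  rewrite -big_split; apply: ler_sum => j _.
  apply: le_trans (h _ (- (tnth x j : R))) _.
  by rewrite opprK lerD2l addrC distrC.
by rewrite lerD2r le_max lexx orbT.
Qed.

Lemma measurable_tnthR j : measurable_fun setT (fun w : euclid R d => tnth w j : R).
Proof. exact: measurable_tnth. Qed.

Lemma measurable_cube_norm : measurable_fun setT cube_norm.
Proof.
apply: measurable_maxr; apply: measurable_sum => j; apply: measurable_realfun.measurable_maxr => //.
- exact: measurable_tnthR.
- by apply: measurableT_comp => //; exact: measurable_tnthR.
Qed.

Lemma measurable_dot x : measurable_fun setT (fun w => dot w x).
Proof.
apply: measurable_sum => j; apply: measurable_funM => //.
exact: measurable_tnthR.
Qed.

End cube_norm.

Section shift_sum.
Context {R : realType}.

(** After cancellation only the first [N] values keep a plus sign, so the bound does not depend on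
    [M]. *)
Lemma sum_shift_diff_le (f : nat -> R) (M N : nat) :
  (forall p, 0 <= f p <= 1) ->
  \sum_(0 <= p < M) (f p - f (p + N)%N) <= N%:R.
Proof.
move=> f01; rewrite sumrB.
have h : \sum_(0 <= p < M) f (p + N)%N = \sum_(N <= p < M + N) f p.
  by rewrite -{2}[N]add0n big_addn addnK.
have e : \sum_(0 <= p < M) f p + \sum_(M <= p < M + N) f p =
         \sum_(0 <= p < N) f p + \sum_(N <= p < M + N) f p.
  by rewrite -!big_cat_nat//= ?leq_addr// leq_addl.
rewrite h; have -> : \sum_(0 <= p < M) f p - \sum_(N <= p < M + N) f p =
    \sum_(0 <= p < N) f p - \sum_(M <= p < M + N) f p by lra.
rewrite lerBlDr ler_wpDr//; first by apply: sumr_ge0 => p _; case/andP: (f01 p).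
apply: (@le_trans _ _ (\sum_(0 <= p < N) 1)).
  by apply: ler_sum => p _; case/andP: (f01 p).
by rewrite sumr_const_nat subn0.
Qed.

Lemma round_inord (n : nat) (u : R) : 0 <= u <= n%:R ->
  0 <= u - (inord (Num.truncn u) : 'I_n.+1)%:R <= 1.
Proof.
move=> /andP[u0 un]; have /andP[h1 h2] := truncn_itv u0.
rewrite inordK ?ltnS; last by rewrite -(ler_nat R) (le_trans h1).
by rewrite subr_ge0 h1 lerBlDr addrC natr1 ltW.
Qed.

End shift_sum.

Section grids.
Context {R : realType} {d : nat}.
Implicit Types (a b w x : euclid R d).

Lemma dot_dist_le a b x (e : R) :
  (forall j, `|(tnth a j : R) - tnth b j| <= e) ->
  (forall j, `|tnth x j : R| <= 1) ->
  `|dot a x - dot b x| <= d%:R * e.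
Proof.
move=> abe x1; rewrite /dot -sumrB; apply: le_trans (ler_norm_sum _ _ _) _.
rewrite mulr_natl -[X in _ *+ X]card_ord -sumr_const; apply: ler_sum => j _.
rewrite -mulrBl normrM -[leRHS]mulr1; exact: ler_pM.
Qed.

Lemma dotC a x : dot a x = dot x a.
Proof. by apply: eq_bigr => j _; rewrite mulrC. Qed.

Lemma unit_cube_norm x j : unit_cube d x -> `|tnth x j : R| <= 1.
Proof. by move=> /(_ j) /andP[x0 x1]; rewrite ger0_norm. Qed.

(* Meaningful for vectors with coordinates in [-1, 1]; the mesh is 1 / Q. *)
Definition cell (Q : nat) a : {ffun 'I_d -> 'I_(Q + Q).+1} :=
  [ffun j => inord (Num.truncn (((tnth a j : R) + 1) * Q%:R))].

Definition corner (Q : nat) (i : {ffun 'I_d -> 'I_(Q + Q).+1}) : euclid R d :=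
  [tuple (i j)%:R / Q%:R - 1 : R | j < d].

Lemma corner_dist (Q : nat) a j : (0 < Q)%N -> `|tnth a j : R| <= 1 ->
  `|(tnth a j : R) - tnth (corner (cell Q a)) j| <= Q%:R^-1.
Proof.
move=> Q0; rewrite ler_norml => /andP[h1 h2].
have Q0' : 0 < Q%:R :> R by rewrite ltr0n.
rewrite tnth_mktuple ffunE.
have /andP[h3 h4] : 0 <= ((tnth a j : R) + 1) * Q%:R
    - (inord (Num.truncn (((tnth a j : R) + 1) * Q%:R)) : 'I_(Q + Q).+1)%:R <= 1.
  apply: round_inord; apply/andP; split; first by apply: mulr_ge0 => //; lra.
  by rewrite natrD; nra.
move: h3 h4; set N := (inord _ : 'I_(Q + Q).+1)%:R => h3 h4.
have -> : (tnth a j : R) - (N / Q%:R - 1) = (((tnth a j : R) + 1) * Q%:R - N) / Q%:R.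
  by field; rewrite gt_eqF.
rewrite ger0_norm; last by rewrite divr_ge0// ltW.
by rewrite ler_pdivrMr// mulVf// gt_eqF.
Qed.

Definition grid_point (L : nat) (i : {ffun 'I_d -> 'I_L.+1}) : euclid R d :=
  [tuple (i j)%:R / L%:R : R | j < d].

Lemma unit_cube_grid_point (L : nat) (i : {ffun 'I_d -> 'I_L.+1}) :
  (0 < L)%N -> unit_cube d (grid_point i).
Proof.
move=> L0 j; rewrite tnth_mktuple.
by rewrite divr_ge0 ?ler0n//= ler_pdivrMr ?ltr0n// mul1r ler_nat -ltnS.
Qed.

Lemma grid_point_near (L : nat) x : (0 < L)%N -> unit_cube d x ->
  exists i : {ffun 'I_d -> 'I_L.+1},
    forall j, `|(tnth x j : R) - tnth (grid_point i) j| <= L%:R^-1.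
Proof.
move=> L0 cx; have L0' : 0 < L%:R :> R by rewrite ltr0n.
pose r j : 'I_L.+1 := inord (Num.truncn ((tnth x j : R) * L%:R)).
exists [ffun j => r j] => j; rewrite tnth_mktuple ffunE.
have /andP[x0 x1] := cx j.
have /andP[h3 h4] : 0 <= (tnth x j : R) * L%:R - (r j)%:R <= 1.
  by apply: round_inord; rewrite mulr_ge0 ?ler0n//= ler_piMl.
have -> : (tnth x j : R) - (r j)%:R / L%:R = ((tnth x j : R) * L%:R - (r j)%:R) / L%:R.
  by field; rewrite gt_eqF.
rewrite ger0_norm; last by rewrite divr_ge0// ltW.
by rewrite ler_pdivrMr// mulVf// gt_eqF.
Qed.

End grids.

Section wave_sums.
Context {R : realType} {d : nat}.

Definition wave (a b : R) (w x : euclid R d) : R :=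
  a * (cos (dot w x) - 1) - b * sin (dot w x).

(* Oscillation of [logistic (tau * (u' - t))] over [|u' - u| <= 1/m] and
   [l/m <= t <= (l+1)/m]. *)
Definition stratum_osc (tau u : R) (m l : nat) : R :=
  logistic (tau * (u - (l%:R - 1) / m%:R)) -
  logistic (tau * (u - (l%:R + 2) / m%:R)).

(* The logistic function being monotone, the oscillations telescope. *)
Lemma stratum_sum_le (tau u : R) (m M' : nat) : (0 < m)%N -> (0 < M')%N ->
  0 <= tau ->
  \sum_(p < m * M') stratum_osc tau u m (p %/ M') <= 4 * M'%:R.
Proof.
move=> m0 M'0 tau0; pose M := (m * M')%N; pose osc l := stratum_osc tau u m l.
have mR : 0 < m%:R :> R by rewrite ltr0n.
have M'R : 0 < M'%:R :> R by rewrite ltr0n.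
have MR : 0 < M%:R :> R by rewrite /M natrM mulr_gt0.
(* As l/m <= p/M <= (l+1)/m, both (l-1)/m and (l+2)/m lie between p/M - 2/m and p/M + 2/m: a window
   of width 4/m, that is, [4 * M'] indices. *)
pose f (p : nat) := logistic (tau * (u + 2 / m%:R - p%:R / M%:R)).
rewrite -/M -(big_mkord xpredT (fun p => osc (p %/ M')%N)).
have -> : 4 * M'%:R = (4 * M')%:R :> R by rewrite natrM.
apply: le_trans (sum_shift_diff_le (f := f) M (4 * M') _); last first.
  by move=> p; rewrite logistic_ge0 logistic_le1.
apply: ler_sum => p _; set l := (p %/ M')%N.
have lp : l%:R / m%:R <= p%:R / M%:R :> R.
  rewrite ler_pdivrMr// mulrAC ler_pdivlMr// -!natrM ler_nat.
  by rewrite /M mulnCA [leqLHS]mulnC leq_mul2r leq_divM orbT.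
have pl : p%:R / M%:R <= (l%:R + 1) / m%:R :> R.
  rewrite ler_pdivrMr// mulrAC ler_pdivlMr// natr1 -!natrM ler_nat.
  by rewrite /M mulnCA [leqLHS]mulnC leq_mul2l ltnW ?orbT// ltn_ceil.
apply: lerB; apply: logistic_le; apply: ler_wpM2l => //.
  have -> : u - (l%:R - 1) / m%:R = u + 2 / m%:R - (l%:R + 1) / m%:R by field; rewrite gt_eqF.
  by rewrite lerD2l lerN2.
have -> : (p + 4 * M')%:R / M%:R = p%:R / M%:R + 4 / m%:R :> R.
  by rewrite /M natrD !natrM; field; rewrite !gt_eqF.
have -> : (l%:R + 2) / m%:R = l%:R / m%:R + 2 / m%:R :> R by rewrite mulrDl.
have -> : u + 2 / m%:R - (p%:R / M%:R + 4 / m%:R) = u - (p%:R / M%:R + 2 / m%:R).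
  by field; rewrite !gt_eqF.
by rewrite lerD2l lerN2 lerD2r.
Qed.

(** Normalized to have |direction . x| <= 1 on the cube. The two signs allow all thresholds to be
    taken in [0, 1]. If the norm is 0, division makes this the zero vector. *)
Definition direction (w : euclid R d) (e : bool) : euclid R d :=
  [tuple (-1) ^+ e * (tnth w j : R) / cube_norm w | j < d].

(** At s = direction . x, with [x] in the cube, this is a cos (w . x) - b sin (w . x): the sign
    enters twice and cancels. *)
Definition profile (a b : R) (w : euclid R d) (e : bool) (s : R) : R :=
  a * cos (cube_norm w * (-1) ^+ e * s) - b * sin (cube_norm w * (-1) ^+ e * s).

Definition wave_size (a b : R) (w : euclid R d) : R :=
  Num.sqrt (a ^+ 2 + b ^+ 2) * cube_norm w.

Lemma wave_size_ge0 a b w : 0 <= wave_size a b w.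
Proof. by rewrite mulr_ge0 ?sqrtr_ge0 ?cube_norm_ge0. Qed.

Lemma profile_lipschitz a b w e s t :
  `|profile a b w e s - profile a b w e t| <= wave_size a b w * `|s - t|.
Proof.
apply: le_trans (wave_lipschitz _ _ _ _ _) _.
by rewrite normrM normrX normrN1 expr1n mulr1 (ger0_norm (cube_norm_ge0 w)).
Qed.

Lemma dot_direction w e x :
  dot (direction w e) x = (-1) ^+ e * dot w x / cube_norm w.
Proof.
rewrite /dot mulr_sumr mulr_suml; apply: eq_bigr => j _.
by rewrite tnth_mktuple; ring.
Qed.

Lemma norm_dot_direction_le1 w e x : unit_cube d x -> `|dot (direction w e) x| <= 1.
Proof.
move=> cx; rewrite dot_direction !normrM normrX normrN1 expr1n mul1r normfV.
rewrite (ger0_norm (cube_norm_ge0 w)).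
have [->|N0] := eqVneq (cube_norm w) 0; first by rewrite invr0 mulr0.
rewrite ler_pdivrMr ?mul1r ?norm_dot_le//.
by rewrite lt_neqAle eq_sym N0 cube_norm_ge0.
Qed.

Lemma norm_tnth_direction_le1 w e j : `|tnth (direction w e) j : R| <= 1.
Proof.
rewrite tnth_mktuple !normrM normrX normrN1 expr1n mul1r normfV.
rewrite (ger0_norm (cube_norm_ge0 w)).
have [->|N0] := eqVneq (cube_norm w) 0; first by rewrite invr0 mulr0.
rewrite ler_pdivrMr ?mul1r ?norm_tnth_le//.
by rewrite lt_neqAle eq_sym N0 cube_norm_ge0.
Qed.

Definition ridge_coef (M : nat) a b w e (p : nat) : R :=
  profile a b w e (p.+1%:R / M%:R) - profile a b w e (p%:R / M%:R).

Lemma norm_ridge_coef_le (M : nat) a b w e p : (0 < M)%N ->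
  `|ridge_coef M a b w e p| <= wave_size a b w / M%:R.
Proof.
move=> M0; apply: le_trans (profile_lipschitz _ _ _ _ _ _) _.
rewrite -mulrBl -natrB// subSn// subnn mul1r ger0_norm// invr_ge0 ler0n//.
Qed.

(** The two values [s e] are opposite, so at most one is positive and the other half contributes 0:
    the wave is the sum of the increments of [profile] from 0 to [Num.max (s e) 0], and [ridge_half]
    applies to each. *)
Lemma wave_ridge_approx (a b tau : R) (w x : euclid R d) (M : nat) :
  0 < tau -> (0 < M)%N -> unit_cube d x ->
  `|wave a b w x - \sum_(e : bool) \sum_(p < M) ridge_coef M a b w e p *
      logistic (tau * (dot (direction w e) x - p%:R / M%:R))|
    <= wave_size a b w * (2 * (2 / tau + 3 / M%:R)).
Proof.
move=> tau0 M0 cx; pose s e := dot (direction w e) x.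
have sle e : s e <= 1.
  by have := norm_dot_direction_le1 w e cx; rewrite ler_norml => /andP[].
have half e := ridge_half (wave_size_ge0 a b w) (profile_lipschitz a b w e)
  tau0 M0 (sle e).
have Ns (e : bool) : cube_norm w * (-1) ^+ e * s e = dot w x.
  rewrite /s dot_direction mulrA (mulrAC _ _ ((-1) ^+ e * _)) mulrA.
  have [N0|N0] := eqVneq (cube_norm w) 0.
    by have := norm_dot_le w cx; rewrite N0 normr_le0 => /eqP ->; rewrite !mulr0 ?mul0r.
  rewrite (_ : _ / _ = ((-1) ^+ e * (-1) ^+ e) * dot w x); last by field.
  by rewrite -expr2 sqrr_sign mul1r.
have waveE : wave a b w x = \sum_(e : bool)
    (profile a b w e (Num.max (s e) 0) - profile a b w e 0).
  have sN : s true = - s false.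
    by rewrite /s !dot_direction expr1 expr0 mul1r !mulN1r mulNr.
  rewrite big_bool /= /wave /profile !mulr0 cos0 sin0.
  have := Ns false; have := Ns true; rewrite sN.
  have [s0|s0] := leP (s false) 0.
    rewrite max_l ?oppr_ge0// => -> _; rewrite !mulr0 cos0 sin0; ring.
  rewrite max_r ?oppr_le0 1?ltW// => _ ->; rewrite !mulr0 cos0 sin0; ring.
rewrite waveE -sumrB big_bool /=.
apply: le_trans (ler_normD _ _) _.
apply: le_trans (lerD (half true) (half false)) _.
by rewrite le_eqVlt; apply/orP; left; apply/eqP; field; rewrite !gt_eqF ?ltr0n.
Qed.

End wave_sums.

Section networks_from_waves.
Context {R : realType} {d : nat}.

Definition neuron (u : R * euclid R d * R) (x : euclid R d) : R :=
  u.1.1 * logistic (dot u.1.2 x + u.2).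

(** The population is made of the units (wave, sign, threshold), with mass |coefficient|. The error
    adds the replacement of waves by units, the move from x to a grid point (once for the
    population, once for the sample) and the sampling error at grid points. *)
Lemma net_of_waves (I : finType) (a b : I -> R) (w : I -> euclid R d)
    (W tau lam T : R) (k m M' L : nat) :
  (0 < d)%N -> (0 < k)%N -> (0 < M')%N -> (0 < L)%N -> 0 < W -> 0 < tau ->
  \sum_i 2 * wave_size (a i) (b i) (w i) <= W -> 0 <= lam <= 4^-1 ->
  ((L.+1 ^ d) * 2)%:R * expR (2 * lam ^+ 2 * (k%:R * (4 / m.+1%:R)))
    < expR (lam * T) ->
  exists t : seq (R * euclid R d * R),
    [/\ (size t <= k)%N,
        forall u, u \in t -> [/\ `|u.1.1| <= W / k%:R,
          forall j, `|tnth u.1.2 j : R| <= tau & `|u.2| <= tau] &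
        forall x, unit_cube d x ->
          `|\sum_i wave (a i) (b i) (w i) x - \sum_(u <- t) neuron u x| <=
          W * (2 / tau + 3 / (m.+1 * M')%:R) + 2 * W * (tau * (d%:R / L%:R)) +
          W / k%:R * (((d * m.+1 + d * m.+1).+1 ^ d * m.+1 * 2)%:R + T)].
Proof.
move=> d0 k0 M'0 L0 W0 tau0 sumW lam01 hT.
set M := (m.+1 * M')%N; have M0 : (0 < M)%N by rewrite muln_gt0.
have MR : 0 < M%:R :> R by rewrite ltr0n.
have kR : 0 < k%:R :> R by rewrite ltr0n.
have mR : 0 < m.+1%:R :> R by rewrite ltr0n.
have M'R : 0 < M'%:R :> R by rewrite ltr0n.
have dR : 0 < d%:R :> R by rewrite ltr0n.
have LR : 0 < L%:R :> R by rewrite ltr0n.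
(* With mesh 1 / Q on d coordinates, dot products with points of the cube vary by at most 1 / (m +
   1) inside a cell. *)
set Q := (d * m.+1)%N; have Q0 : (0 < Q)%N by rewrite muln_gt0 d0.
pose P : finType := (I * bool * 'I_M)%type.
pose coef (p : P) : R := ridge_coef M (a p.1.1) (b p.1.1) (w p.1.1) p.1.2 p.2.
pose dir (p : P) := direction (w p.1.1) p.1.2.
pose thr (p : P) : R := (p.2 : nat)%:R / M%:R.
have sumP (F : I -> bool -> 'I_M -> R) :
    \sum_(p : P) F p.1.1 p.1.2 p.2 = \sum_i \sum_e \sum_q F i e q.
  rewrite -(pair_bigA _ (fun ie q => F ie.1 ie.2 q)) /=.
  by rewrite -(pair_bigA _ (fun i e => \sum_q F i e q)).
pose act (p : P) x := logistic (tau * (dot (dir p) x - thr p)).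
pose K : finType := ({ffun 'I_d -> 'I_(Q + Q).+1} * 'I_m.+1 * bool)%type.
(* The sign of the coefficient belongs to the key, since it is carried by [y]: units of opposite
   signs are not close to each other. *)
pose key (p : P) : K :=
  (cell Q (dir p), inord ((p.2 : nat) %/ M'), coef p < 0).
have keyM (p : P) : nat_of_ord (key p).1.2 = ((p.2 : nat) %/ M')%N.
  by rewrite inordK// ltn_divLR//; exact: ltn_ord.
pose sg (p : P) : R := (-1) ^+ (coef p < 0)%R.
have coefE p : `|coef p| * sg p = coef p by rewrite mulrC -realEsign ?num_real.
pose y (p : P) (i : {ffun 'I_d -> 'I_L.+1}) := sg p * act p (grid_point i).
have cgrid (i : {ffun 'I_d -> 'I_L.+1}) : unit_cube d (@grid_point R d L i).
  exact: unit_cube_grid_point.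
pose osc (c : K) (i : {ffun 'I_d -> 'I_L.+1}) : R :=
  stratum_osc tau (dot (corner c.1.1) (grid_point i)) m.+1 c.1.2.
have mu_sum : \sum_p `|coef p| <= W.
  apply: le_trans sumW.
  rewrite (sumP (fun i e q => `|ridge_coef M (a i) (b i) (w i) e q|)).
  apply: ler_sum => i _; rewrite big_bool /= [leRHS]mulr_natl mulr2n.
  by apply: lerD; (apply: (@le_trans _ _ (\sum_(q < M) wave_size (a i) (b i) (w i) / M%:R));
    [apply: ler_sum => q _; exact: norm_ridge_coef_le|
     rewrite sumr_const card_ord -[leLHS]mulr_natr divfK// gt_eqF]).
have act01 p x : 0 <= act p x <= 1 by rewrite logistic_ge0 logistic_le1.
have y1 p i : `|y p i| <= 1.
  by rewrite /y normrMsign; have /andP[h1 h2] := act01 p (grid_point i); rewrite ger0_norm.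
have bracket p x : unit_cube d x ->
  logistic (tau * (dot (corner (cell Q (dir p))) x - (((key p).1.2 : nat)%:R + 2) / m.+1%:R)) <= act p x
  <= logistic (tau * (dot (corner (cell Q (dir p))) x - (((key p).1.2 : nat)%:R - 1) / m.+1%:R)).
  move=> cx; rewrite keyM; set l := (_ %/ _)%N.
  have : `|dot (dir p) x - dot (corner (cell Q (dir p))) x| <= m.+1%:R^-1.
    have -> : m.+1%:R^-1 = d%:R * Q%:R^-1 :> R.
      by rewrite /Q natrM; field; rewrite !gt_eqF.
    apply: dot_dist_le => j; last exact: unit_cube_norm.
    by apply: corner_dist => //; exact: norm_tnth_direction_le1.
  have lp : l%:R / m.+1%:R <= thr p.
    rewrite /thr ler_pdivrMr// mulrAC ler_pdivlMr// -!natrM ler_nat.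
    by rewrite /M mulnCA [leqLHS]mulnC leq_mul2r leq_divM orbT.
  have pl : thr p <= (l%:R + 1) / m.+1%:R.
    rewrite /thr ler_pdivrMr// mulrAC ler_pdivlMr// natr1 -!natrM ler_nat.
    by rewrite /M mulnCA [leqLHS]mulnC leq_mul2l ltnW ?orbT// ltn_ceil.
  rewrite ler_distl => /andP[h1 h2]; rewrite !mulrDl mulN1r mul1r in pl lp *.
  move: pl lp h1 h2; set e := m.+1%:R^-1; set q := l%:R * e; set D1 := dot _ _; set D2 := dot _ _; set th := thr p => pl lp h1 h2.
  rewrite /act -/D2 -/th.
  by apply/andP; split; apply: logistic_le; rewrite ler_pM2l//; lra.

have osc_pq p q i : key p = key q -> `|y p i - y q i| <= osc (key p) i.
  move=> pq; rewrite /y; have epq : (coef q < 0) = (coef p < 0) by case: pq.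
  rewrite /sg epq -mulrBr normrMsign /osc /stratum_osc.
  have := bracket p _ (cgrid i); have := bracket q _ (cgrid i).
  have -> : cell Q (dir q) = (key p).1.1 by rewrite pq.
  have -> : cell Q (dir p) = (key p).1.1 by [].
  rewrite -pq => /andP[h1 h2] /andP[h3 h4].
  by rewrite ler_norml; apply/andP; split; lra.
have osc01 c i : 0 <= osc c i <= 1.
  apply/andP; split.
    rewrite subr_ge0; apply: logistic_le; rewrite ler_pM2l//.
    by rewrite lerD2l lerN2 ler_pM2r ?invr_gt0//; lra.
  by rewrite lerBlDr ler_wpDr ?logistic_ge0 ?logistic_le1.
(* Since [osc] lies in [0, 1], its square is at most [osc], whose sum over the thresholds of one
   direction is at most [4 * M'] out of [M]. *)
have var i : \sum_p `|coef p| * osc (key p) i ^+ 2 <= W * (4 / m.+1%:R).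
  apply: (@le_trans _ _ (\sum_(p : P) wave_size (a p.1.1) (b p.1.1) (w p.1.1) / M%:R *
      stratum_osc tau (dot (corner (cell Q (direction (w p.1.1) p.1.2))) (grid_point i))
        m.+1 ((p.2 : nat) %/ M'))).
    apply: ler_sum => p _; apply: ler_pM => //.
    - by rewrite sqr_ge0.
    - exact: norm_ridge_coef_le.
    - rewrite -keyM -/(dir p); have /andP[h0 h1] := osc01 (key p) i.
      by rewrite expr2 -[leRHS]mulr1; apply: ler_pM.
  rewrite (sumP (fun i' e q => wave_size (a i') (b i') (w i') / M%:R *
      stratum_osc tau (dot (corner (cell Q (direction (w i') e))) (grid_point i)) m.+1
       ((q : nat) %/ M'))).
  apply: (@le_trans _ _ ((\sum_i0 2 * wave_size (a i0) (b i0) (w i0)) * (4 / m.+1%:R))); last first.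
    by rewrite ler_wpM2r// divr_ge0// ltW.
  rewrite mulr_suml; apply: ler_sum => i0 _; rewrite big_bool /= -!mulr_sumr.
  rewrite mulr_natl mulr2n mulrDl.
  have -> : 4 / m.+1%:R = M%:R^-1 * (4 * M'%:R) :> R.
    by rewrite /M natrM; field; rewrite !gt_eqF.
  by apply: lerD; rewrite -[leLHS]mulrA ler_wpM2l ?wave_size_ge0// ler_wpM2l ?invr_ge0 ?ler0n//;
    apply: stratum_sum_le => //; exact: ltW.
have cardX : (#|{ffun 'I_d -> 'I_L.+1}| * 2 = L.+1 ^ d * 2)%N.
  by rewrite card_ffun !card_ord.
rewrite -cardX in hT.
have [t szt ht] := stratified_sampling (fun p => normr_ge0 (coef p)) mu_sum W0 y1
  osc_pq var lam01 hT k0.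
have Wk0 : 0 <= W / k%:R by rewrite divr_ge0// ltW.
have cardK : #|K| = ((Q + Q).+1 ^ d * m.+1 * 2)%N.
  by rewrite !card_prod card_ffun !card_ord card_bool.
pose unit_of (p : P) : R * euclid R d * R :=
  (sg p * (W / k%:R), [tuple tau * (tnth (dir p) j : R) | j < d], - (tau * thr p)).
have neuronE p x : neuron (unit_of p) x = W / k%:R * (sg p * act p x).
  rewrite /neuron /= (_ : dot _ x = tau * dot (dir p) x).
    by rewrite /act mulrBr; ring.
  rewrite /dot mulr_sumr; apply: eq_bigr => j _.
  by rewrite tnth_mktuple mulrA.
exists (map unit_of t); split.
- by rewrite size_map.
- move=> u /mapP[p _ ->] /=; split.
  + by rewrite normrMsign ger0_norm.
  + move=> j; rewrite tnth_mktuple normrM (gtr0_norm tau0) ler_piMr ?(ltW tau0)//.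
    exact: norm_tnth_direction_le1.
  + rewrite normrN normrM (gtr0_norm tau0) ler_piMr ?(ltW tau0)//.
    by rewrite ger0_norm ?divr_ge0 ?ler0n// ler_pdivrMr// mul1r ler_nat ltnW.
move=> x cx; have [i near] := grid_point_near L0 cx.
have actx p : `|act p x - act p (grid_point i)| <= tau * (d%:R / L%:R).
  apply: le_trans (logistic_lipschitz _ _) _.
  rewrite -mulrBr opprB addrA subrK normrM (gtr0_norm tau0) ler_pM2l//.
  rewrite dotC (dotC _ (grid_point i)); apply: dot_dist_le => // j.
  exact: norm_tnth_direction_le1.
rewrite big_map; under [X in _ - X]eq_bigr do rewrite neuronE.
rewrite -mulr_sumr.
have h1 : `|\sum_i wave (a i) (b i) (w i) x - \sum_p coef p * act p x| <=
    W * (2 / tau + 3 / M%:R).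
  rewrite (sumP (fun i e q => ridge_coef M (a i) (b i) (w i) e q *
    logistic (tau * (dot (direction (w i) e) x - (q : nat)%:R / M%:R)))).
  rewrite -sumrB; apply: le_trans (ler_norm_sum _ _ _) _.
  apply: (@le_trans _ _ ((\sum_i 2 * wave_size (a i) (b i) (w i)) * (2 / tau + 3 / M%:R))).
    rewrite mulr_suml; apply: ler_sum => i0 _.
    by apply: le_trans (wave_ridge_approx _ _ _ tau0 M0 cx) _; rewrite mulrCA mulrA.
  by rewrite ler_wpM2r// addr_ge0// divr_ge0 ?ler0n ?(ltW tau0).
have h2 : `|\sum_p coef p * act p x - \sum_p coef p * act p (grid_point i)| <=
    W * (tau * (d%:R / L%:R)).
  rewrite -sumrB; apply: le_trans (ler_norm_sum _ _ _) _.
  apply: (@le_trans _ _ ((\sum_p `|coef p|) * (tau * (d%:R / L%:R)))).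
    by rewrite mulr_suml; apply: ler_sum => p _; rewrite -mulrBr normrM ler_wpM2l.
  by rewrite ler_wpM2r// mulr_ge0 ?divr_ge0 ?ler0n ?(ltW tau0).
have h3 := ht i; rewrite cardK in h3.
have h4 : `|W / k%:R * (\sum_(p <- t) y p i) - W / k%:R * (\sum_(p <- t) sg p * act p x)| <=
    W * (tau * (d%:R / L%:R)).
  rewrite -mulrBr -sumrB normrM (ger0_norm Wk0).
  apply: (@le_trans _ _ (W / k%:R * (k%:R * (tau * (d%:R / L%:R))))); last first.
    by rewrite mulrA divfK// gt_eqF.
  rewrite ler_wpM2l//; apply: le_trans (ler_norm_sum _ _ _) _.
  apply: (@le_trans _ _ (\sum_(p <- t) tau * (d%:R / L%:R))).
    by apply: ler_sum => p _; rewrite /y -mulrBr normrMsign distrC.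
  rewrite big_const_seq count_predT iter_addr_0 -[leLHS]mulr_natl ler_wpM2r ?ler_nat//.
  by rewrite mulr_ge0 ?divr_ge0 ?ler0n ?(ltW tau0).
have E : \sum_p coef p * act p (grid_point i) = \sum_p `|coef p| * y p i.
  by apply: eq_bigr => p _; rewrite /y mulrA coefE.
rewrite E in h2.
set A := \sum_i _ in h1 *; set B := \sum_p coef p * _ in h1 h2.
set C := \sum_p `|_| * _ in h2 h3; set D := W / k%:R * _ in h3 h4.
set F := W / k%:R * _ in h4 *.
rewrite (_ : A - F = (A - B) + (B - C) + (C - D) + (D - F)); last by ring.
apply: le_trans (le_trans _ (lerD (lerD (lerD h1 h2) h3) h4)) _.
  apply: le_trans (ler_normD _ _) _; rewrite lerD2r.
  by apply: le_trans (ler_normD _ _) _; rewrite lerD2r ler_normD.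
by rewrite le_eqVlt; apply/orP; left; apply/eqP; ring.
Qed.

End networks_from_waves.

(** * Choice of the parameters and the rate k^(-1/2) *)

(** With e = (N + 1) / c, exp (c n) is the (N + 1)-th power of exp (n / e), which is at least n / e:
    one degree more than the polynomial. *)
Lemma expR_gt_poly (R : realType) (A c : R) (N : nat) : 0 < c ->
  exists n0 : nat, forall n, (n0 <= n)%N -> A * n.+1%:R ^+ N < expR (c * n%:R).
Proof.
move=> c0; wlog A0 : A / 0 <= A.
  move=> H; have [n0 hn0] := H `|A| (normr_ge0 A).
  exists n0 => n /hn0; apply: le_lt_trans; by rewrite ler_wpM2r ?ler_norm ?exprn_ge0.
pose e := N.+1%:R / c; have e0 : 0 < e by rewrite divr_gt0.
exists (Num.truncn (A * 2 ^+ N * e ^+ N.+1)).+1 => n hn.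
have n1 : A * 2 ^+ N * e ^+ N.+1 < n%:R.
  have h0 : 0 <= A * 2 ^+ N * e ^+ N.+1 by rewrite !mulr_ge0 ?exprn_ge0 ?(ltW e0).
  have /andP[_ h] := truncn_itv h0; apply: lt_le_trans h _.
  by rewrite ler_nat.
have n0 : 0 < n%:R :> R by rewrite ltr0n (leq_trans _ hn).
have cE : c * n%:R = N.+1%:R * (n%:R / e).
  by rewrite /e; field; rewrite !gt_eqF//= ltr0n.
rewrite cE expRM_natl; clear cE; clearbody e.
apply: (@lt_le_trans _ _ ((n%:R / e) ^+ N.+1)); last first.
  rewrite lerXn2r ?nnegrE ?expR_ge0 ?divr_ge0 ?ler0n ?(ltW e0) ?(ltW c0)//.
  by apply: (le_trans _ (expR_ge1Dx _)); rewrite lerDr.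
rewrite expr_div_n ltr_pdivlMr ?exprn_gt0//.
apply: (@le_lt_trans _ _ (A * 2 ^+ N * e ^+ N.+1 * n%:R ^+ N)); last first.
  by rewrite [ltRHS]exprS ltr_pM2r// exprn_gt0.
rewrite [leRHS](_ : _ = A * (2 * n%:R) ^+ N * e ^+ N.+1); last by rewrite exprMn [LHS]mulrAC !mulrA.
rewrite ler_wpM2r ?exprn_ge0 ?(ltW e0)// ler_wpM2l// lerXn2r ?nnegrE ?mulr_ge0 ?ler0n//.
by rewrite -natrM ler_nat; lia.
Qed.

Section rate.
Context {R : realType} {d : nat}.

Lemma norm_wave_le (a b : R) (w x : euclid R d) : unit_cube d x ->
  `|wave a b w x| <= wave_size a b w.
Proof.
move=> cx; have := wave_lipschitz a b 1 (dot w x) 0.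
rewrite !mul1r cos0 sin0 mulr1 mulr0 !subr0 normr1 mulr1 => h.
rewrite /wave (_ : _ - _ = a * cos (dot w x) - b * sin (dot w x) - a); last by ring.
apply: le_trans h _; rewrite ler_wpM2l ?sqrtr_ge0//; exact: norm_dot_le.
Qed.

(* With [mu ^ (2 (d + 1)) ~ k] there are O(sqrt k) strata, and the exponential
   factor [expR (mu / 32)] beats the number of grid points, polynomial in [mu]. *)
Lemma net_rate : (0 < d)%N -> exists2 C : R, 0 <= C &
  forall (I : finType) (a b : I -> R) (w : I -> euclid R d) (W : R) (k : nat),
  (0 < k)%N -> 0 < W -> \sum_i 2 * wave_size (a i) (b i) (w i) <= W ->
  let tau := Num.sqrt k%:R * ln k%:R in
  exists t : seq (R * euclid R d * R),
    [/\ (size t <= k)%N,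
        forall u, u \in t -> [/\ `|u.1.1| <= W / k%:R,
          forall j, `|tnth u.1.2 j : R| <= tau & `|u.2| <= tau] &
        forall x, unit_cube d x ->
          `|\sum_i wave (a i) (b i) (w i) x - \sum_(u <- t) neuron u x| <=
          C * W / Num.sqrt k%:R].
Proof.
move=> d0.
have c32 : 0 < 32^-1 :> R by rewrite invr_gt0.
have [mu0 hmu0] := expR_gt_poly (((d.+1 ^ d) * 2)%:R) (4 * d.+1 * d) c32.
(* From [K0] on, the number of cells is large enough for the union bound and ln k >= 1. Below, the
   empty network has error at most [W], and sqrt K0 enters the constant. *)
pose K0 := maxn (maxn mu0 1 ^ (2 * d.+1)) (Num.truncn (expR 1 : R)).+1.
pose C1 : R := 8 + 2 * ((2 * d).+1 ^ d)%:R.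
have C10 : 0 <= C1 by rewrite addr_ge0// mulr_ge0.
exists (C1 + Num.sqrt K0%:R); first by rewrite addr_ge0// sqrtr_ge0.
move=> I a b w W k k0 W0 sumW tau; rewrite /tau.
set s : R := Num.sqrt k%:R.
have kR : 0 < k%:R :> R by rewrite ltr0n.
have s0 : 0 < s by rewrite sqrtr_gt0.
have ss : s ^+ 2 = k%:R by rewrite sqr_sqrtr// ltW.
have [kK|Kk] := ltnP k K0.
  exists [::]; split => // x cx; rewrite big_nil subr0.
  apply: le_trans (ler_norm_sum _ _ _) _.
  apply: (@le_trans _ _ W).
    apply: le_trans sumW; apply: ler_sum => i _.
    by apply: le_trans (norm_wave_le _ _ _ cx) _; rewrite ler_peMl ?wave_size_ge0 ?ler1n.
  rewrite ler_pdivlMr// mulrC ler_wpM2r ?(ltW W0)// ler_wpDl//.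
  by rewrite ler_sqrt ?ler0n// ler_nat ltnW.
have [mu [mule musup mu1]] : exists mu, [/\ (mu.+1 ^ (2 * d.+1) <= k)%N,
    (k < mu.+2 ^ (2 * d.+1))%N & (mu0 <= mu.+1)%N].
  have ex : exists m : nat, (m ^ (2 * d.+1) <= k)%N by exists 1%N; rewrite exp1n.
  have bnd m : (m ^ (2 * d.+1) <= k)%N -> (m <= k)%N.
    by apply: leq_trans; rewrite -{1}[m]expn1; case: m => // m; rewrite leq_pexp2l.
  case: (ex_maxnP ex bnd) => m hm hmax.
  have m1 : (maxn mu0 1 <= m)%N by apply: hmax; apply: leq_trans Kk; rewrite leq_maxl.
  have m0 : (0 < m)%N by apply: leq_trans m1; rewrite leq_maxr.
  exists m.-1; rewrite prednK//; split => //.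
    by rewrite ltnNge; apply/negP => /hmax; rewrite ltnn.
  by apply: leq_trans m1; rewrite leq_maxl.
have lnk1 : 1 <= ln k%:R :> R.
  rewrite -[leLHS]expRK ler_ln ?posrE ?expR_gt0//.
  have /andP[_ h] := truncn_itv (expR_ge0 (1 : R)).
  apply: le_trans (ltW h) _; rewrite ler_nat; apply: leq_trans Kk.
  by rewrite leq_maxr.
have mus : (mu.+1 ^ d.+1)%:R <= s.
  rewrite -(@ler_pXn2r _ 2) ?nnegrE ?ler0n ?(ltW s0)// ss -natrX ler_nat.
  by rewrite -expnM mulnC.
have s1 : 1 <= s.
  by apply: le_trans mus; rewrite ler1n expn_gt0.
have mu_s : mu.+1%:R <= s.
  by apply: le_trans mus; rewrite ler_nat -{1}[mu.+1]expn1 leq_pexp2l.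
have tau0 : 0 < s * ln k%:R by rewrite mulr_gt0// (lt_le_trans ltr01).
have muR : 0 < mu.+1%:R :> R by rewrite ltr0n.
have dR : 0 < d%:R :> R by rewrite ltr0n.
(* With this grid size, moving x to the grid costs tau d / L = (ln k / k) / sqrt k, and the number
   of grid points stays polynomial in k. *)
have L0 : (0 < d * k ^ 2)%N by rewrite muln_gt0 d0 expn_gt0 k0.
(* With T = s, lam T is (mu + 1) / 16 while the variance term is (mu + 1) / 32; the surplus pays for
   the union bound. *)
pose lam : R := mu.+1%:R / (16 * s).
have lam01 : 0 <= lam <= 4^-1.
  rewrite /lam divr_ge0 ?ler0n ?mulr_ge0 ?(ltW s0)//= ler_pdivrMr ?mulr_gt0//.
  by apply: le_trans mu_s _; lra.
have k2 : (k ^ 2 <= mu.+2 ^ (4 * d.+1))%N.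
  by rewrite -[4%N]/(2 * 2)%N mulnAC expnM leq_exp2r// ltnW.
have hT : (((d * k ^ 2).+1 ^ d) * 2)%:R *
    expR (2 * lam ^+ 2 * (k%:R * (4 / mu.+1%:R))) < expR (lam * s).
  have -> : lam * s = 32^-1 * mu.+1%:R + 32^-1 * mu.+1%:R.
    by rewrite /lam; field; rewrite gt_eqF.
  have -> : 2 * lam ^+ 2 * (k%:R * (4 / mu.+1%:R)) = 32^-1 * mu.+1%:R.
    by rewrite /lam -ss; field; rewrite !gt_eqF.
  rewrite expRD ltr_pM2r ?expR_gt0//.
  apply: le_lt_trans (hmu0 _ mu1).
  rewrite -natrX -natrM ler_nat [leqRHS]mulnAC leq_mul2r /=.
  rewrite expnM -expnMn leq_exp2r//.
  apply: (@leq_trans (d.+1 * k ^ 2)).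
    by rewrite mulSn addnC -addn1 leq_add2l expn_gt0 k0.
  by rewrite leq_mul2l k2 orbT.
have [t [szt tb terr]] := net_of_waves d0 k0 k0 L0 W0 tau0 sumW lam01 hT.
exists t; split => // x cx; apply: le_trans (terr x cx) _.
have Ws0 : 0 <= W / s by rewrite divr_ge0 ?ltW.
have sk : s <= k%:R by rewrite -ss expr2 ler_peMr ?(ltW s0).
have b1 : 2 / (s * ln k%:R) <= 2 / s.
  by rewrite ler_pM2l// lef_pV2 ?posrE// ler_peMr ?(ltW s0).
have b2 : 3 / (mu.+1 * k)%:R <= 3 / s.
  rewrite ler_pM2l// lef_pV2 ?posrE ?ltr0n ?muln_gt0//.
  by apply: le_trans sk _; rewrite ler_nat leq_pmull.
have b3 : s * ln k%:R * (d%:R / (d * k ^ 2)%:R) <= s^-1.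
  have -> : s * ln k%:R * (d%:R / (d * k ^ 2)%:R) = s^-1 * (ln k%:R / k%:R).
    by rewrite natrM natrX -ss; field; rewrite !gt_eqF.
  rewrite ler_piMr ?invr_ge0 ?(ltW s0)// ler_pdivrMr// mul1r ltW//.
  exact: ln_sublinear.
have b4 : ((d * mu.+1 + d * mu.+1).+1 ^ d * mu.+1 * 2)%:R <= 2 * ((2 * d).+1 ^ d)%:R * s.
  apply: (@le_trans _ _ (2 * ((2 * d).+1 ^ d)%:R * (mu.+1 ^ d.+1)%:R)); last first.
    by rewrite ler_wpM2l// mulr_ge0.
  rewrite -!natrM ler_nat.
  apply: (@leq_trans (((2 * d).+1 * mu.+1) ^ d * mu.+1 * 2)).
    rewrite !leq_mul2r leq_exp2r// mulSn mul2n -addnn mulnDl.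
    by rewrite (leq_add (ltn0Sn mu) (leqnn _)) !orbT.
  by rewrite expnMn expnS [leqLHS]mulnC -!mulnA [(mu.+1 ^ d * _)%N]mulnC.
rewrite -[leRHS]mulrA (mulrDl _ _ (W / s)).
apply: (@le_trans _ _ (C1 * (W / s))); last first.
  by rewrite lerDl mulr_ge0// sqrtr_ge0.
apply: (@le_trans _ _ (W * (2 / s + 3 / s) + 2 * W * s^-1 +
    W / k%:R * (2 * ((2 * d).+1 ^ d)%:R * s + s))); last first.
  by rewrite le_eqVlt; apply/orP; left; apply/eqP; rewrite -ss /C1; field; rewrite gt_eqF.
apply: lerD; first apply: lerD.
- by apply: ler_wpM2l; [exact: ltW|exact: lerD].
- by apply: ler_wpM2l => //; rewrite mulr_ge0 ?(ltW W0).
- by apply: ler_wpM2l; [rewrite divr_ge0 ?ler0n ?(ltW W0)|rewrite lerD2r].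
Qed.

End rate.

(** * Discretization of the Fourier measure *)

Section cell_integrals.
Context dT (T : measurableType dT) (R : realType) (I : finType).
Context (A : I -> set T) (U : set T).
Context (mA : forall i, measurable (A i)).
Context (mU : measurable U).
Context (disjA : forall i j x, A i x -> A j x -> i = j).
Context (covA : forall x, U x <-> exists i, A i x).
Implicit Types (mu : {finite_measure set T -> \bar R}) (g : T -> R) (v : I -> R).

Definition step_fun v (x : T) : R := \sum_i v i * \1_(A i) x.

Lemma step_funE v x i : A i x -> step_fun v x = v i.
Proof.
move=> Ai; rewrite /step_fun (bigD1 i)//= indicE mem_set// mulr1.
rewrite big1 ?addr0// => j ji; rewrite indicE memNset ?mulr0//.
by move=> Aj; move/eqP : ji; apply; exact: disjA Aj Ai.
Qed.

Lemma step_fun0 v x : ~ U x -> step_fun v x = 0.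
Proof.
move=> Ux; apply: big1 => j _; rewrite indicE memNset ?mulr0// => Aj.
by apply: Ux; apply/covA; exists j.
Qed.

Lemma measurable_step_fun v : measurable_fun setT (step_fun v).
Proof.
by apply: measurable_sum => i; apply: measurable_funM.
Qed.

Lemma bounded_integrable mu g (B : R) : measurable_fun setT g ->
  (forall x, `|g x| <= B) -> mu.-integrable setT (EFin \o g).
Proof.
move=> mg gB; apply: measurable_bounded_integrable => //.
  by rewrite -ge0_fin_numE// fin_num_measure.
by exists B; split; [exact: num_real|move=> M BM x _ /=; rewrite (le_trans (gB x))// ltW].
Qed.

Lemma norm_step_fun_le v x : `|step_fun v x| <= \sum_i `|v i|.
Proof.
apply: le_trans (ler_norm_sum _ _ _) _; apply: ler_sum => i _.
by rewrite normrM ler_piMr// indicE; case: (_ \in _); rewrite ?normr1 ?normr0.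
Qed.

Lemma Rintegral_step_fun mu v :
  (\int[mu]_x step_fun v x = \sum_i v i * fine (mu (A i)))%R.
Proof.
have sumE (s : seq I) : (\int[mu]_x (\sum_(i <- s) v i * \1_(A i) x) =
    \sum_(i <- s) v i * fine (mu (A i)))%R.
  have int1 i : mu.-integrable setT (EFin \o (\1_(A i) : T -> R)).
    apply: (@bounded_integrable mu _ 1); first exact: measurable_indic.
    by move=> x; rewrite indicE; case: (_ \in _); rewrite ?normr1 ?normr0.
  have int2 i : mu.-integrable setT (EFin \o (fun x => v i * \1_(A i) x)).
    apply: (@bounded_integrable mu _ `|v i|).
      by apply: measurable_funM => //; exact: measurable_indic.
    move=> x; rewrite normrM ler_piMr// indicE.
    by case: (_ \in _); rewrite ?normr1 ?normr0.
  elim: s => [|i s ih].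
    under eq_Rintegral do rewrite big_nil.
    by rewrite Rintegral_cst// mul0r big_nil.
  under eq_Rintegral do rewrite big_cons.
  rewrite RintegralD//; last first.
    have -> : EFin \o (fun x => \sum_(j <- s) v j * \1_(A j) x) =
        (fun x => \sum_(j <- s) (v j * \1_(A j) x)%:E)%E.
      by apply/funext => x /=; rewrite sumEFin.
    by apply: integrable_sum => // j _; exact: int2.
  rewrite big_cons ih RintegralZl//; congr (_ * _ + _).
  by rewrite /Rintegral integral_indic// setIT.
exact: sumE.
Qed.

Lemma Rintegral_cells_approx mu g v (eps B : R) : measurable_fun setT g ->
  0 <= eps -> (forall x, `|g x| <= B) ->
  (forall i x, A i x -> `|g x - v i| <= eps) ->
  `|\int[mu]_x g x - \sum_i v i * fine (mu (A i))|
    <= eps * fine (mu setT) + B * fine (mu (~` U)).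
Proof.
move=> mg eps0 gB gv; rewrite -Rintegral_step_fun -RintegralB//; last 2 first.
- exact: bounded_integrable gB.
- by apply: bounded_integrable (norm_step_fun_le v); exact: measurable_step_fun.
have mh : measurable_fun setT (fun x => g x - step_fun v x).
  by apply: measurable_funB => //; exact: measurable_step_fun.
have hB x : `|g x - step_fun v x| <= B + \sum_i `|v i|.
  by apply: le_trans (ler_normB _ _) _; apply: lerD => //; exact: norm_step_fun_le.
apply: le_trans (le_normr_Rintegral _ _) _ => //.
  exact: bounded_integrable hB.
have mtail : measurable (~` U) by exact: measurableC.
have e1 : (\int[mu]_x (eps + B * \1_(~` U) x) = eps * fine (mu setT) + B * fine (mu (~` U)))%R.
  have i1 : mu.-integrable setT (EFin \o (\1_(~` U) : T -> R)).
    apply: (@bounded_integrable mu _ 1); first exact: measurable_indic.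
    by move=> x; rewrite indicE; case: (_ \in _); rewrite ?normr1 ?normr0.
  rewrite RintegralD//; last 2 first.
  - exact: (@bounded_integrable mu (cst eps) `|eps|).
  - apply: (@bounded_integrable mu _ `|B|).
      by apply: measurable_funM => //; exact: measurable_indic.
    move=> x; rewrite normrM ler_piMr// indicE.
    by case: (_ \in _); rewrite ?normr1 ?normr0.
  by rewrite Rintegral_cst// RintegralZl// /Rintegral integral_indic// setIT.
rewrite -e1; apply: le_Rintegral => //.
- apply: (@bounded_integrable mu _ (B + \sum_i `|v i|)).
    exact: measurableT_comp.
  by move=> x; rewrite normr_id.
- apply: (@bounded_integrable mu _ (eps + `|B|)).
    by apply: measurable_funD => //; apply: measurable_funM.
  move=> x; apply: le_trans (ler_normD _ _) _; rewrite ger0_norm// lerD2l.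
  rewrite normrM ler_piMr// indicE.
  by case: (_ \in _); rewrite ?normr1 ?normr0.
- move=> x _; have [Ux|Ux] := pselect (U x).
    rewrite indicE memNset ?mulr0 ?addr0; last by move=> h; exact: h.
    by have [i Ai] := (covA x).1 Ux; rewrite (step_funE _ Ai); exact: gv.
  by rewrite (step_fun0 _ Ux) subr0 indicE mem_set// mulr1 ler_wpDl.
Qed.

(** Meant for the unbounded weight [cube_norm], hence a one-sided estimate in the extended reals.
    Outside [U] the step function is 0, so no tail appears. *)
Lemma sum_cells_le (mu : {finite_measure set T -> \bar R}) v g (e : R) :
  measurable_fun setT g -> (forall x, 0 <= g x) -> 0 <= e -> (forall i, 0 <= v i) ->
  (forall i x, A i x -> v i <= g x + e) ->
  (\sum_i (v i * fine (mu (A i)))%:E <= \int[mu]_x (g x)%:E + (e * fine (mu setT))%:E)%E.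
Proof.
move=> mg g0 e0 v0 vg.
have -> : (\sum_i (v i * fine (mu (A i)))%:E = \int[mu]_x (step_fun v x)%:E)%E.
  rewrite sumEFin -Rintegral_step_fun /Rintegral fineK//.
  apply: integrable_fin_num => //.
  apply: bounded_integrable (norm_step_fun_le v); exact: measurable_step_fun.
have -> : ((e * fine (mu setT))%:E = \int[mu]_x e%:E)%E.
  by rewrite integral_cst// EFinM fineK// fin_num_measure.
rewrite -ge0_integralD//; last 2 first.
- by move=> x _; rewrite lee_fin.
- exact/measurable_EFinP.
apply: ge0_le_integral => //.
- move=> x _; rewrite lee_fin; apply: sumr_ge0 => i _.
  by rewrite mulr_ge0// indicE ler0n.
- by apply/measurable_EFinP; exact: measurable_step_fun.
- by apply: emeasurable_funD; [exact/measurable_EFinP|exact: measurable_cst].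
move=> x _; rewrite -EFinD lee_fin; have [Ux|Ux] := pselect (U x).
  by have [i Ai] := (covA x).1 Ux; rewrite (step_funE _ Ai); exact: vg.
by rewrite (step_fun0 _ Ux) addr_ge0.
Qed.

End cell_integrals.

Section charges.
Context dT (T : measurableType dT) (R : realType).

(** Hides the chosen Hahn decomposition behind two finite measures. *)
Lemma charge_integral_parts (nu : {charge set T -> \bar R}) :
  exists m1 m2 : {finite_measure set T -> \bar R},
    (forall g, charge_integral nu g = \int[m1]_x g x - \int[m2]_x g x) /\
    (forall A, measurable A -> fine (nu A) = fine (m1 A) - fine (m2 A)).
Proof.
pose nuPN := projT2 (cid (projT2 (cid (Hahn_decomposition nu)))).
exists (jordan_pos nuPN), (jordan_neg nuPN); split => // A mA.
rewrite (jordan_decomp nuPN mA) /cadd /= cscaleN1.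
by rewrite fineD ?fin_numN ?fin_num_measure// fineN.
Qed.

(** The partition A, set0, set0, ... is one of those in the supremum. *)
Lemma cmodulus_le_magnitude (nu : complex_measure T R)
    (F : {finite_measure set T -> \bar R}) (A : set T) :
  is_magnitude nu F -> measurable A -> cmodulus nu A <= fine (F A).
Proof.
move=> FA mA; rewrite -lee_fin fineK ?fin_num_measure// FA//.
apply: ereal_sup_ubound; exists (fun n => if n is 0%N then A else set0).
  split; first by case.
    by apply/trivIsetP => -[|i] [|j] _ _ //=; rewrite ?setI0 ?set0I.
  apply/seteqP; split => [x [[|n] _]//|x Ax]; by exists 0%N.
rewrite (nneseries_split 0 1)//; last by move=> k _; rewrite lee_fin sqrtr_ge0.
rewrite add0n big_nat1 eseries0 ?adde0// => -[|k]// _ _.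
by rewrite /cmodulus !charge0 /= expr0n/= addr0 sqrtr0.
Qed.

End charges.

Section boxes.
Context {R : realType} {d : nat}.

Lemma measurable_box (a b : 'I_d -> R) :
  measurable [set w : euclid R d | forall j, a j <= (tnth w j : R) < b j].
Proof.
have -> : [set w : euclid R d | forall j, a j <= (tnth w j : R) < b j] =
    \big[setI/setT]_(j < d)
    ((fun x : euclid R d => tnth x j : measurableTypeR R) @^-1` `[a j, b j[%classic).
  rewrite -bigcap_seq; apply/seteqP; split=> x /= hx j.
    by move=> _ /=; rewrite in_itv/=; exact: hx.
  by have := hx j (mem_index_enum _); rewrite /= in_itv.
apply: bigsetI_measurable => j _; rewrite -[X in measurable X]setTI.
have h := @measurable_tnth _ (measurableTypeR R) d j.
by apply: h => //; exact: measurable_itv.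
Qed.

Definition big_box (r : nat) : set (euclid R d) :=
  [set w | forall j, - r%:R <= (tnth w j : R) < r%:R].

(** Half-open, so that for N = 2 r q these boxes of side 1 / q partition [big_box r]. *)
Definition box (r q N : nat) (i : {ffun 'I_d -> 'I_N}) : set (euclid R d) :=
  [set w | forall j, (i j)%:R / q%:R - r%:R <= (tnth w j : R) < (i j).+1%:R / q%:R - r%:R].

Definition box_corner (r q N : nat) (i : {ffun 'I_d -> 'I_N}) : euclid R d :=
  [tuple (i j)%:R / q%:R - r%:R : R | j < d].

Lemma big_box_cover (r q : nat) (w : euclid R d) : (0 < q)%N ->
  big_box r w <-> exists i : {ffun 'I_d -> 'I_(2 * r * q)}, box r q i w.
Proof.
move=> q0; have qR : 0 < q%:R :> R by rewrite ltr0n.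
split => [bw|[i bi] j]; last first.
  have /andP[h1 h2] := bi j; apply/andP; split.
    by apply: le_trans h1; rewrite lerBrDr addNr divr_ge0.
  apply: lt_le_trans h2 _; rewrite lerBlDr ler_pdivrMr// -natrD -natrM ler_nat.
  by rewrite addnn -mul2n.
have hw j : 0 <= ((tnth w j : R) + r%:R) * q%:R.
  by have /andP[h1 h2] := bw j; rewrite mulr_ge0// -lerBlDr sub0r.
have hN j : (Num.truncn (((tnth w j : R) + r%:R) * q%:R) < 2 * r * q)%N.
  have /andP[h1 h2] := bw j; have /andP[h3 _] := truncn_itv (hw j).
  rewrite -(ltr_nat R); apply: le_lt_trans h3 _.
  by rewrite !natrM ltr_pM2r// mulr_natl mulr2n ltrD2r.
exists [ffun j => Ordinal (hN j)] => j; rewrite !ffunE /=.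
have /andP[h3 h4] := truncn_itv (hw j).
by rewrite lerBlDr ltrBrDr ler_pdivrMr// ltr_pdivlMr// h3.
Qed.

Lemma box_disjoint (r q N : nat) (i i' : {ffun 'I_d -> 'I_N}) (w : euclid R d) :
  (0 < q)%N -> box r q i w -> box r q i' w -> i = i'.
Proof.
move=> q0 bi bi'; apply/ffunP => j; apply/val_inj/eqP.
have qR : 0 < q%:R :> R by rewrite ltr0n.
have le (u v : {ffun 'I_d -> 'I_N}) : box r q u w -> box r q v w -> (u j <= v j)%N.
  move=> /(_ j)/andP[h1 _] /(_ j)/andP[_ h2].
  have := le_lt_trans h1 h2; rewrite ltrD2r ltr_pM2r ?invr_gt0// ltr_nat.
  by rewrite ltnS.
by rewrite eqn_leq !le.
Qed.

Lemma box_corner_dist (r q N : nat) (i : {ffun 'I_d -> 'I_N}) (w : euclid R d) j :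
  box r q i w -> `|(tnth w j : R) - tnth (box_corner r q i) j| <= q%:R^-1.
Proof.
move=> /(_ j)/andP[h1 h2]; rewrite tnth_mktuple ger0_norm ?subr_ge0//.
move: h2; rewrite -natr1 mulrDl mul1r; lra.
Qed.

(** Continuity from above: the complements decrease to the empty set. *)
Lemma big_box_tail (mu : {finite_measure set (euclid R d) -> \bar R}) (e : R) :
  0 < e -> \forall r \near \oo, fine (mu (~` big_box r)) <= e.
Proof.
move=> e0.
have mB r : measurable (~` big_box r) by apply: measurableC; exact: measurable_box.
have B0 : \bigcap_r (~` big_box r) = set0.
  rewrite -subset0 => w /= hw.
  pose M := \sum_(j < d) `|tnth w j : R|.
  have M0 : 0 <= M by exact: sumr_ge0.
  have /andP[_ h] := truncn_itv M0.
  apply: (hw (Num.truncn M).+1 Logic.I) => j.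
  have : `|tnth w j : R| < (Num.truncn M).+1%:R.
    by apply: le_lt_trans h; rewrite /M (bigD1 j)//= lerDl sumr_ge0.
  by rewrite ltr_norml => /andP[/ltW -> ->].
have := nonincreasing_cvg_mu (mu := mu) (F := fun r => ~` big_box r) _ mB.
rewrite B0 measure0 => /(_ _ measurable0) cv.
have {cv}/fine_cvgP[_ /cvgr0Pnorm_le/(_ _ e0)] :
    (mu (~` big_box r) @[r --> \oo] --> 0%:E)%E.
  apply: cv; first by rewrite -ge0_fin_numE// fin_num_measure.
  move=> r s rs; apply/subsetPset => w /= h1 h2; apply: h1 => j.
  have /andP[h3 h4] := h2 j.
  have rsR : r%:R <= s%:R :> R by rewrite ler_nat.
  by apply/andP; split; lra.
apply: filterS => r /=; apply: le_trans; exact: ler_norm.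
Qed.

End boxes.

Section finite_wave_representation.
Context {R : realType} {d : nat}.
Implicit Types (f : euclid R d -> R) (w x : euclid R d).

(** The two measures come before [r], [q] and [g]: radius and mesh are chosen from their masses and
    tails, and then serve for all x at once. *)
Lemma charge_cells_approx (nu : {charge set (euclid R d) -> \bar R}) :
  exists m1 m2 : {finite_measure set (euclid R d) -> \bar R},
  (forall g, charge_integral nu g = \int[m1]_x g x - \int[m2]_x g x) /\
  forall (r q : nat) (g : euclid R d -> R)
    (v : {ffun 'I_d -> 'I_(2 * r * q)} -> R) (eps B : R),
  (0 < q)%N -> measurable_fun setT g -> 0 <= eps -> (forall w, `|g w| <= B) ->
  (forall i w, box r q i w -> `|g w - v i| <= eps) ->
  `|charge_integral nu g - \sum_i v i * fine (nu (box r q i))| <=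
     eps * (fine (m1 setT) + fine (m2 setT)) +
     B * (fine (m1 (~` big_box r)) + fine (m2 (~` big_box r))).
Proof.
have [m1 [m2 [hi hA]]] := charge_integral_parts nu.
exists m1, m2; split => // r q g v eps B q0 mg eps0 gB gv.
have mA i : measurable (@box R d r q (2 * r * q) i) by exact: measurable_box.
have mU : measurable (@big_box R d r) by exact: measurable_box.
have dis (i j : {ffun 'I_d -> 'I_(2 * r * q)}) w :
  box r q i w -> box r q j w -> i = j by exact: box_disjoint.
have cov w := big_box_cover r w q0.
have h m := Rintegral_cells_approx mA mU dis cov m mg eps0 gB gv.
rewrite hi; under eq_bigr do rewrite hA// mulrBr.
rewrite sumrB.
rewrite (_ : _ - _ - (_ - _) =
  (\int[m1]_x g x - \sum_i v i * fine (m1 (box r q i))) -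
  (\int[m2]_x g x - \sum_i v i * fine (m2 (box r q i)))); last by ring.
apply: le_trans (ler_normB _ _) _; apply: le_trans (lerD (h m1) (h m2)) _.
by rewrite le_eqVlt; apply/orP; left; apply/eqP; ring.
Qed.

Lemma measurable_cos_dot x : measurable_fun setT (fun w => cos (dot w x)).
Proof.
apply: (@measurableT_comp _ _ _ _ _ _ (@cos R)); last exact: measurable_dot.
by apply: continuous_measurable_fun; exact: continuous_cos.
Qed.

Lemma measurable_sin_dot x : measurable_fun setT (fun w => sin (dot w x)).
Proof.
apply: (@measurableT_comp _ _ _ _ _ _ (@sin R)); last exact: measurable_dot.
by apply: continuous_measurable_fun; exact: continuous_sin.
Qed.

Lemma dot_origin w : dot w (origin d) = 0.
Proof. by apply: big1 => j _; rewrite tnth_mktuple mulr0. Qed.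

(** One wave per box, with the mass of the box as amplitude and its corner as frequency. The modulus
    of that mass is at most the magnitude of the box, so the wave sizes sum to little more than the
    Barron integral. *)
Lemma barron_finite_waves f (c delta : R) : 0 < delta ->
  (barron_const f <= c%:E)%E ->
  exists (I : finType) (a b : I -> R) (w : I -> euclid R d) (f0 : R),
    [/\ `|f0| <= c + delta,
        \sum_i wave_size (a i) (b i) (w i) <= c + delta &
        forall x, unit_cube d x ->
          `|f x - (f0 + \sum_i wave (a i) (b i) (w i) x)| <= delta].
Proof.
move=> de0 fc.
(* The infimum may not be attained: half of the slack is spent here. *)
have [_ [c' [c'0 [h [nu [F [fr mag hc']]] fh]] <-] c'lt] :
    exists2 z, [set c%:E | c in [set c : R | 0 <= c /\
      exists2 h, barron_class c h & {in unit_cube d, f =1 h}]] z &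
      (z < (c + delta / 2)%:E)%E.
  apply: ereal_inf_lt; apply: le_lt_trans fc _.
  by rewrite lte_fin ltrDl divr_gt0.
rewrite lte_fin in c'lt.
have [m1 [m2 [hre are]]] := charge_cells_approx (re_part nu).
have [m3 [m4 [him aim]]] := charge_cells_approx (im_part nu).
pose Mt := fine (m1 setT) + fine (m2 setT) + (fine (m3 setT) + fine (m4 setT)) +
  fine (F setT).
have fT (m : {finite_measure set (euclid R d) -> \bar R}) A : 0 <= fine (m A).
  by rewrite fine_ge0.
have Mt0 : 0 <= Mt by rewrite !addr_ge0.
have D0 : 0 <= d%:R * Mt * (4 / delta) by apply: mulr_ge0; [exact: mulr_ge0|rewrite divr_ge0 ?(ltW de0)].
have /andP[_ hq] := truncn_itv D0.
set q := (Num.truncn (d%:R * Mt * (4 / delta))).+1 in hq.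
have qR : 0 < q%:R :> R by rewrite ltr0n.
have meshM : d%:R / q%:R * Mt <= delta / 4.
  rewrite mulrAC ler_pdivrMr// [leRHS]mulrC -ler_pdivrMr; last by rewrite divr_gt0.
  by apply: le_trans (ltW hq); rewrite invf_div.
(* Four tails, each multiplied by the bound 2 on the integrands, cost delta / 4; the mesh costs
   another delta / 4. *)
have e0 : 0 < delta / 32 by rewrite divr_gt0.
have [r [[t1 t2] [t3 t4]]] : exists r,
  (fine (m1 (~` big_box r)) <= delta / 32 /\ fine (m2 (~` big_box r)) <= delta / 32) /\
  (fine (m3 (~` big_box r)) <= delta / 32 /\ fine (m4 (~` big_box r)) <= delta / 32).
  near \oo => r; exists r; split; split; near: r; exact: big_box_tail.
pose I : finType := {ffun 'I_d -> 'I_(2 * r * q)}.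
pose w (i : I) : euclid R d := box_corner r q i.
pose a (i : I) := fine (re_part nu (box r q i)).
pose b (i : I) := fine (im_part nu (box r q i)).
have mA (i : I) : measurable (@box R d r q (2 * r * q) i) by exact: measurable_box.
have eps0 : 0 <= d%:R / q%:R :> R by rewrite divr_ge0.
have [hB h0] : (\int[F]_w dual_norm w <= c'%:E)%E /\ `|h (origin d)| <= c'.
  by move: hc'; rewrite ge_max => /andP[? ?]; split.
exists I, a, b, w, (h (origin d)); split.
- by apply: le_trans h0 _; lra.
- rewrite -lee_fin; apply: (@le_trans _ _ (\sum_i (cube_norm (w i) * fine (F (box r q i)))%:E)%E).
    rewrite sumEFin lee_fin; apply: ler_sum => i _; rewrite /wave_size mulrC.
    by apply: ler_wpM2l; [exact: cube_norm_ge0|exact: cmodulus_le_magnitude].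
  apply: (@le_trans _ _ (\int[F]_w (cube_norm w)%:E + (d%:R / q%:R * fine (F setT))%:E)%E).
    have dis (i j : I) (u : euclid R d) : box r q i u -> box r q j u -> i = j by exact: box_disjoint.
    have cov (u : euclid R d) := big_box_cover r u (isT : (0 < q)%N).
    apply: (sum_cells_le mA dis cov) => //.
    + exact: measurable_cube_norm.
    + exact: cube_norm_ge0.
    + by move=> i; exact: cube_norm_ge0.
    + move=> i u bu; apply: le_trans (cube_norm_le_dist _ u) _; rewrite lerD2l.
      apply: (@le_trans _ _ (\sum_(j < d) q%:R^-1)).
        by apply: ler_sum => j _; rewrite distrC; exact: box_corner_dist.
      by rewrite sumr_const card_ord mulr_natl.
  under eq_integral do rewrite -dual_normE.
  apply: le_trans (leeD2r _ hB) _; rewrite -EFinD lee_fin.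
  have : d%:R / q%:R * fine (F setT) <= delta / 4.
    by apply: le_trans meshM; rewrite ler_wpM2l// /Mt lerDr !addr_ge0.
  lra.
move=> x cx; rewrite fh ?inE//.
have [hx _] := fr x; have [ho _] := fr (origin d).
pose g1 (u : euclid R d) := cos (dot u x) - 1.
pose g2 (u : euclid R d) := sin (dot u x).
have mg1 : measurable_fun setT g1.
  by apply: measurable_funB => //; exact: measurable_cos_dot.
have mg2 : measurable_fun setT g2 by exact: measurable_sin_dot.
(* Only cos - 1 and sin remain, which is the form of [wave]; both vanish at frequency 0. *)
have hdiff : h x - h (origin d) =
    charge_integral (re_part nu) g1 - charge_integral (im_part nu) g2.
  have g1E (m : {finite_measure set (euclid R d) -> \bar R}) :
      (\int[m]_u g1 u = \int[m]_u cos (dot u x) - \int[m]_u cos (dot u (origin d)))%R.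
    have bnd z : m.-integrable setT (EFin \o (fun u : euclid R d => cos (dot u z))).
      apply: (@bounded_integrable _ _ _ m _ 1); first exact: measurable_cos_dot.
      by move=> u; exact: cos_max.
    rewrite -RintegralB//; apply: eq_Rintegral => u _.
    by rewrite dot_origin cos0.
  have g2E (m : {finite_measure set (euclid R d) -> \bar R}) :
      (\int[m]_u sin (dot u (origin d)) = 0)%R.
    under eq_Rintegral do rewrite dot_origin sin0.
    by rewrite Rintegral_cst// mul0r.
  rewrite hx ho !hre !him !g1E !g2E; ring.
have dd (i : I) (u : euclid R d) : box r q i u -> `|dot u x - dot (w i) x| <= d%:R / q%:R.
  move=> bu; apply: dot_dist_le => j; first exact: box_corner_dist.
  exact: unit_cube_norm.
have A1 : `|charge_integral (re_part nu) g1 - \sum_i (cos (dot (w i) x) - 1) * a i| <=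
    d%:R / q%:R * (fine (m1 setT) + fine (m2 setT)) + 2 * (delta / 32 + delta / 32).
  apply: le_trans (are r q g1 (fun i => cos (dot (w i) x) - 1) _ 2 isT mg1 eps0 _ _) _.
  - move=> u; apply: le_trans (ler_normB _ _) _; rewrite normr1 [leRHS]mulr2n lerD2r.
    exact: cos_max.
  - move=> i u bu; rewrite /g1 opprB addrA subrK.
    by apply: le_trans (norm_cos_sub_le _ _) _; exact: dd.
  - by rewrite lerD2l ler_pM2l// lerD.
have A2 : `|charge_integral (im_part nu) g2 - \sum_i sin (dot (w i) x) * b i| <=
    d%:R / q%:R * (fine (m3 setT) + fine (m4 setT)) + 2 * (delta / 32 + delta / 32).
  apply: le_trans (aim r q g2 (fun i => sin (dot (w i) x)) _ 2 isT mg2 eps0 _ _) _.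
  - by move=> u; apply: le_trans (sin_max _) _; rewrite ler1n.
  - by move=> i u bu; apply: le_trans (norm_sin_sub_le _ _) _; exact: dd.
  - by rewrite lerD2l ler_pM2l// lerD.
have -> : \sum_i wave (a i) (b i) (w i) x =
    \sum_i (cos (dot (w i) x) - 1) * a i - \sum_i sin (dot (w i) x) * b i.
  by rewrite -sumrB; apply: eq_bigr => i _; rewrite /wave; ring.
set S1 := \sum_i _ in A1 *; set S2 := \sum_i _ in A2 *.
rewrite (_ : _ - _ = (charge_integral (re_part nu) g1 - S1) -
   (charge_integral (im_part nu) g2 - S2)); last first.
  have -> : h x = h (origin d) + (h x - h (origin d)) by ring.
  rewrite hdiff; ring.
apply: le_trans (ler_normB _ _) _; apply: le_trans (lerD A1 A2) _.
have : d%:R / q%:R * (fine (m1 setT) + fine (m2 setT) + (fine (m3 setT) + fine (m4 setT)))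
    <= delta / 4.
  by apply: le_trans meshM; rewrite ler_wpM2l// /Mt lerDl.
rewrite mulrDr; lra.
Unshelve. all: by end_near.
Qed.

End finite_wave_representation.

(** * The upper bound for Barron functions *)

Section upper_bound.
Context {R : realType} {d : nat}.
Implicit Types (f : euclid R d -> R) (w x : euclid R d).

Lemma waveZ (t a b : R) w x : wave (t * a) (t * b) w x = t * wave a b w x.
Proof. by rewrite /wave; ring. Qed.

Lemma wave_sizeZ (t a b : R) w : 0 <= t ->
  wave_size (t * a) (t * b) w = t * wave_size a b w.
Proof.
move=> t0; rewrite /wave_size !exprMn -mulrDr sqrtrM ?sqr_ge0//.
by rewrite sqrtr_sqr ger0_norm// mulrA.
Qed.

(** Lists shorter than [k] are padded with the zero neuron, the default value of [nth]. *)
Lemma shallow_nets_of_seq (k : nat) (a1 a2 a3 b0 : R) (t : seq (R * euclid R d * R)) :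
  0 <= a1 -> 0 <= a2 -> (size t <= k)%N ->
  (forall u, u \in t -> [/\ `|u.1.1| <= a2,
     forall j, `|tnth u.1.2 j : R| <= a1 & `|u.2| <= a1]) -> `|b0| <= a3 ->
  shallow_nets k a1 a2 a3 (fun x => \sum_(u <- t) neuron u x + b0).
Proof.
move=> a10 a20 tk tb b0a; pose u0 : R * euclid R d * R := (0, origin d, 0).
pose u i := nth u0 t i.
have ub i : [/\ `|(u i).1.1| <= a2, forall j, `|tnth (u i).1.2 j : R| <= a1 & `|(u i).2| <= a1].
  have [it|it] := ltnP i (size t); first by apply: tb; exact: mem_nth.
  rewrite /u nth_default//=; split=> [|j|]; rewrite ?normr0//.
  by rewrite tnth_mktuple normr0.
exists (fun i : 'I_k => (u i).1.1), (fun i : 'I_k => (u i).1.2), (fun i : 'I_k => (u i).2), b0.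
split => // [x|i|i]; last 2 first.
- by have [_ h1 h2] := ub i; split.
- by have [] := ub i.
congr (_ + _); rewrite (big_nth u0) -(big_mkord xpredT (fun i => neuron (u i) x)).
rewrite [RHS](big_cat_nat (n := size t))//= [X in _ + X]big_nat [X in _ + X]big1 ?addr0//.
by move=> i /andP[it _]; rewrite /neuron /u nth_default//= mul0r.
Qed.

Lemma barron_upper_bound : (0 < d)%N -> exists chat : R,
  forall (c : R), 0 <= c -> forall (k : nat), (0 < k)%N ->
  forall f, (barron_const f <= c%:E)%E ->
  exists2 g, shallow_nets_star k c g &
    forall x, unit_cube d x ->
      `|f x - g x| <= ((chat + 2) * c + 2) * k%:R `^ (- 2^-1).
Proof.
move=> d0; have [C C0 hC] := @net_rate R d d0.
exists (2 * C) => c c0 k k0 f fc.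
have kR : 0 < k%:R :> R by rewrite ltr0n.
set s : R := Num.sqrt k%:R.
have s0 : 0 < s by rewrite sqrtr_gt0.
have -> : k%:R `^ (- 2^-1) = s^-1 by rewrite powRN powR12_sqrt// ltW.
pose delta : R := s^-1 / 2.
have de0 : 0 < delta by rewrite divr_gt0// invr_gt0.
have [I [a [b [w [f0 [f0c sumc apx]]]]]] := barron_finite_waves de0 fc.
have cd0 : 0 < c + delta by rewrite ltr_wpDl.
(* Brings the sizes from c + delta back to c, as the class demands. Since |f0 + S| <= 2 (c + delta),
   this costs 2 delta; with the discretization, 3 delta <= 2 / sqrt k in all. *)
pose th := c / (c + delta).
have th0 : 0 <= th by rewrite divr_ge0// ltW.
have thc : th * (c + delta) = c by rewrite divfK// gt_eqF.
have th1 : th <= 1 by rewrite ler_pdivrMr// mul1r lerDl ltW.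
have ln0 : 0 <= s * ln k%:R by rewrite mulr_ge0 ?(ltW s0)// ln_ge0// ler1n.
have [t [szt tb terr]] : exists t : seq (R * euclid R d * R),
    [/\ (size t <= k)%N,
        forall u, u \in t -> [/\ `|u.1.1| <= 2 * k%:R^-1 * c,
          forall j, `|tnth u.1.2 j : R| <= s * ln k%:R & `|u.2| <= s * ln k%:R] &
        forall x, unit_cube d x ->
          `|th * (\sum_i wave (a i) (b i) (w i) x) - \sum_(u <- t) neuron u x| <=
          2 * C * c / s].
  (* For c = 0 the total mass [W] would not be positive; here [th] = 0 and the empty list does. *)
  have [c1|c1] := leP c 0.
    have c00 : c = 0 by apply/eqP; rewrite eq_le c1 c0.
    exists [::]; split => // x cx.
    by rewrite big_nil /th c00 mul0r mul0r subrr normr0 mulr0 mul0r.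
  have W0 : 0 < 2 * c by rewrite mulr_gt0.
  have sumW : \sum_i 2 * wave_size (th * a i) (th * b i) (w i) <= 2 * c.
    under eq_bigr do rewrite wave_sizeZ//.
    by rewrite -!mulr_sumr ler_pM2l// -thc ler_wpM2l.
  have [t [h1 h2 h3]] := hC I _ _ w (2 * c) k k0 W0 sumW.
  exists t; split => // [u /h2[]|x cx].
    by rewrite (mulrAC 2).
  rewrite mulr_sumr; under eq_bigr do rewrite -waveZ.
  by apply: le_trans (h3 x cx) _; rewrite mulrCA mulrA.
exists (fun x => \sum_(u <- t) neuron u x + th * f0).
  apply: shallow_nets_of_seq => //; first by rewrite !mulr_ge0// invr_ge0 ler0n.
  by rewrite normrM ger0_norm// -[leRHS]thc ler_wpM2l.
move=> x cx; have h1 := apx x cx; have h2 := terr x cx.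
have hS : `|\sum_i wave (a i) (b i) (w i) x| <= c + delta.
  apply: le_trans (ler_norm_sum _ _ _) _; apply: le_trans sumc.
  by apply: ler_sum => i _; exact: norm_wave_le.
move: h1 h2 hS; set S := \sum_i wave _ _ _ _; set Z := \sum_(u <- t) _ => h1 h2 hS.
have h3 : `|(1 - th) * (f0 + S)| <= 2 * delta.
  rewrite normrM ger0_norm ?subr_ge0//.
  apply: (@le_trans _ _ ((1 - th) * ((c + delta) + (c + delta)))).
    rewrite ler_wpM2l ?subr_ge0//; apply: le_trans (ler_normD _ _) _.
    exact: lerD.
  by rewrite -mulr2n mulrnAr mulrBl mul1r thc addrC addKr mulr_natl.
rewrite (_ : _ - _ = (f x - (f0 + S)) + (1 - th) * (f0 + S) + (th * S - Z)); last by ring.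
apply: le_trans (ler_normD _ _) _.
apply: le_trans (lerD (le_trans (ler_normD _ _) (lerD h1 h3)) h2) _.
have hc : 0 <= c * s^-1 by rewrite mulr_ge0// invr_ge0 ltW.
have hs : 0 < s^-1 by rewrite invr_gt0.
have -> : ((2 * C + 2) * c + 2) / s = 2 * C * c / s + 2 * (c * s^-1) + 2 * s^-1 by ring.
have -> : delta + 2 * delta = s^-1 + s^-1 / 2 by rewrite /delta; field; rewrite gt_eqF.
by rewrite addrC -addrA lerD2l; lra.
Qed.

Lemma ess_sup_le_cube (P : probability (euclid R d) R) (h : euclid R d -> \bar R) (y : \bar R) :
  P (unit_cube d) = 1%E -> (forall x, unit_cube d x -> (h x <= y)%E) ->
  (ess_sup P h <= y)%E.
Proof.
move=> P1 hy; apply/ess_supP; exists (~` unit_cube d); split.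
- by apply: measurableC; exact: measurable_unit_cube.
- apply: etrans (probability_setC P (@measurable_unit_cube R d)) _.
  by rewrite P1 subee.
- by move=> x /= hx cx; apply: hx; exact: hy.
Qed.

End upper_bound.

(** * Iterated finite differences *)

Section finite_differences.
Context {R : realType}.
Implicit Types (u v : R -> R) (h t s K : R).

Definition fdiff h u : R -> R := fun t => u (t + h) - u t.

Definition nfdiff h (n : nat) u : R -> R := iter n (fdiff h) u.

Lemma nfdiffS h n u t : nfdiff h n.+1 u t = nfdiff h n u (t + h) - nfdiff h n u t.
Proof. by []. Qed.

Lemma nfdiffD h n u v t :
  nfdiff h n (fun t => u t + v t) t = nfdiff h n u t + nfdiff h n v t.
Proof. by elim: n t => // n ih t; rewrite !nfdiffS !ih; ring. Qed.

Lemma nfdiffZ h n (a : R) u t : nfdiff h n (fun t => a * u t) t = a * nfdiff h n u t.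
Proof. by elim: n t => // n ih t; rewrite !nfdiffS !ih; ring. Qed.

Lemma nfdiffB h n u v t :
  nfdiff h n (fun t => u t - v t) t = nfdiff h n u t - nfdiff h n v t.
Proof. by elim: n t => // n ih t; rewrite !nfdiffS !ih; ring. Qed.

Lemma nfdiff_sum h n (I : Type) (r : seq I) (u : I -> R -> R) t :
  nfdiff h n (fun t => \sum_(i <- r) u i t) t = \sum_(i <- r) nfdiff h n (u i) t.
Proof.
elim: n t => // n ih t; rewrite nfdiffS !ih -sumrB.
by apply: eq_bigr => i _; rewrite nfdiffS.
Qed.

Lemma eq_nfdiff h n u v t : u =1 v -> nfdiff h n u t = nfdiff h n v t.
Proof. by move=> uv; elim: n t => // n ih t; rewrite !nfdiffS !ih. Qed.

Lemma nfdiff_periodic h n u t : (forall t, u (t + h) = u t) -> nfdiff h n.+1 u t = 0.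
Proof.
move=> uh; elim: n t => [|n ih] t; first by rewrite /nfdiff /= /fdiff uh subrr.
by rewrite nfdiffS !ih subrr.
Qed.

Lemma norm_nfdiff_le h n u t (B : R) :
  (forall j, (j <= n)%N -> `|u (t + j%:R * h)| <= B) -> `|nfdiff h n u t| <= 2 ^+ n * B.
Proof.
elim: n t => [|n ih] t uB; first by have := uB 0%N isT; rewrite mul0r addr0 mul1r.
rewrite nfdiffS exprS -mulrA mulr_natl mulr2n.
apply: le_trans (ler_normB _ _) _; apply: lerD.
  apply: ih => j jn; have := uB j.+1 jn; rewrite -natr1 mulrDl mul1r.
  by rewrite addrA addrAC.
by apply: ih => j jn; apply: uB; exact: leqW.
Qed.

Lemma is_derive_shift u (du : R -> R) h : (forall t, is_derive t 1 u (du t)) ->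
  forall t, is_derive t 1 (fun t => u (t + h)) (du (t + h)).
Proof.
move=> hu t.
have h1 : is_derive t (1 : R) (fun t : R => t + h) 1.
  by apply: is_derive_eq; rewrite addr0.
have h2 := hu (t + h).
have := @is_derive1_comp R u (fun t => t + h) t (du (t + h)) 1 h2 h1.
by rewrite mulr1.
Qed.

Lemma is_derive_nfdiff h n u (du : R -> R) : (forall t, is_derive t 1 u (du t)) ->
  forall t, is_derive t 1 (nfdiff h n u) (nfdiff h n du t).
Proof.
move=> hu; elim: n => // n ih t.
have h1 := is_derive_shift h ih t.
exact: (is_deriveB h1 (ih t)).
Qed.

(** Differences commute with derivation, so the mean value theorem trades one difference for a
    factor h and a derivative. *)
Lemma norm_nfdiffS_le h n u (du : R -> R) K t : 0 <= h ->
  (forall t, is_derive t 1 u (du t)) -> (forall t, `|nfdiff h n du t| <= K) ->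
  `|nfdiff h n.+1 u t| <= h * K.
Proof.
move=> h0 hu hK; rewrite nfdiffS.
have hd := is_derive_nfdiff h n hu.
have leth : t <= t + h by rewrite lerDl.
have cont : {within `[t, t + h], continuous (nfdiff h n u)}.
  apply: continuous_subspaceT => x; apply: differentiable_continuous.
  by apply/derivable1_diffP; have [] := hd x.
have [c _ ->] := MVT_segment leth (fun x _ => hd x) cont.
by rewrite addrC addKr normrM (ger0_norm h0) mulrC ler_wpM2l.
Qed.

(** From cos (m + e) - cos (m - e) = 2 sin e cos (m + pi / 2). The factor 2 sin (omega h / 2) is 2
    for omega h = pi and at most 1 in absolute value for |omega h| <= 1: this separates one term of
    the lacunary sum from the earlier ones. *)
Lemma nfdiff_cos h n (omega p t : R) :
  nfdiff h n (fun t => cos (omega * t + p)) t =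
  (2 * sin (omega * h / 2)) ^+ n *
    cos (omega * t + p + n%:R * (omega * h / 2 + pi / 2)).
Proof.
elim: n t => [|n ih] t; first by rewrite mul0r addr0 mul1r.
rewrite nfdiffS !ih -mulrBr exprSr; set e := omega * h / 2.
rewrite -[RHS]mulrA; congr (_ * _); set m := omega * t + p + n%:R * (e + pi / 2) + e.
have -> : omega * (t + h) + p + n%:R * (e + pi / 2) = m + e.
  by rewrite /m /e; field.
have -> : omega * t + p + n%:R * (e + pi / 2) = m - e by rewrite /m; ring.
have -> : omega * t + p + n.+1%:R * (e + pi / 2) = m + pi / 2.
  by rewrite /m -natr1; ring.
by rewrite cosDpihalf cosD cosB; ring.
Qed.

Lemma norm_nfdiff_cos_le1 h n (omega p t : R) : `|omega * h| <= 1 ->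
  `|nfdiff h n (fun t => cos (omega * t + p)) t| <= 1.
Proof.
move=> oh; rewrite nfdiff_cos normrM -[leRHS]mulr1; apply: ler_pM => //.
  rewrite normrX exprn_ile1// normrM (ger0_norm (ler0n R 2)).
  apply: le_trans (ler_wpM2l _ (norm_sin_le _)) _ => //.
  by rewrite normrM (ger0_norm (x := 2^-1))// mulrCA mulfV// mulr1.
exact: cos_max.
Qed.

(* This family contains the logistic units and its span is stable under
   differentiation. *)
Definition logmon (a b : nat) (w p t : R) : R :=
  logistic (w * t + p) ^+ a * (1 - logistic (w * t + p)) ^+ b.

Lemma is_derive_logistic t : is_derive t 1 (@logistic R) (logistic t * (1 - logistic t)).
Proof.
rewrite /logistic.
have h1 : is_derive t (1 : R) (fun x : R => 1 + expR (- x)) (- expR (- t)).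
  have h0 : is_derive t (1 : R) (fun x : R => expR (- x)) (- expR (- t)).
    have hN : is_derive t (1 : R) (fun x : R => - x) (-1) by exact: is_deriveN.
    have := @is_derive1_comp R expR (fun x : R => - x) t _ _ (is_derive_expR _) hN.
    by rewrite mulrN1.
  have := is_deriveD (is_derive_cst (1 : R) t 1) h0.
  by rewrite add0r.
have e0 := oneDexpN_gt0 t.
have ne : 1 + expR (- t) != 0 by rewrite gt_eqF.
have h2 := @is_deriveV R (fun x : R => 1 + expR (- x)) t _ 1 ne h1.
apply: (is_derive_eq h2); rewrite /GRing.scale /=.
by field; rewrite ne.
Qed.

Lemma is_derive_logmon (a b : nat) (w p t : R) :
  is_derive t 1 (logmon a b w p)
    (w * (a%:R * logmon a b.+1 w p t - b%:R * logmon a.+1 b w p t)).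
Proof.
pose y (t : R) := logistic (w * t + p).
have hy : is_derive t (1 : R) y (w * (y t * (1 - y t))).
  have hl : is_derive t (1 : R) (fun t : R => w * t + p) w.
    by apply: is_derive_eq; rewrite addr0 /GRing.scale /= mulr1.
  have := @is_derive1_comp R (@logistic R) (fun t : R => w * t + p) t _ _
    (is_derive_logistic _) hl.
  by rewrite mulrC.
have hy' : is_derive t (1 : R) (fun t => 1 - y t) (- (w * (y t * (1 - y t)))).
  have := is_deriveB (is_derive_cst (1 : R) t 1) hy.
  by rewrite sub0r.
have h1 := is_deriveX a hy; have h2 := is_deriveX b hy'.
have h3 := is_deriveM h1 h2.
have -> : logmon a b w p = (y ^+ a * (fun t => 1 - y t) ^+ b).
  by apply/funext => s; rewrite !exprfctE.
apply: (is_derive_eq h3); rewrite /GRing.scale /= !exprfctE /logmon -/(y t).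
case: a {h1 h3} => [|a]; case: b {h2} => [|b] /=; rewrite ?exprS; ring.
Qed.

(** Each derivation raises a + b by one while n drops by one, so a fixed [N] above a + b + n bounds
    the coefficients throughout the induction. *)
Lemma norm_nfdiff_logmon_le h n N (a b : nat) (w p t : R) : 0 <= h ->
  (a + b + n <= N)%N ->
  `|nfdiff h n (logmon a b w p) t| <= (h * `|w| * N%:R) ^+ n.
Proof.
move=> h0; elim: n a b t => [|n ih] a b t abN.
  rewrite /nfdiff /= expr0 /logmon.
  have y0 := logistic_ge0 (w * t + p); have y1 := logistic_le1 (w * t + p).
  by rewrite ger0_norm ?mulr_ge0 ?mulr_ile1 ?exprn_ge0 ?exprn_ile1 ?subr_ge0 ?lerBlDr ?lerDl.
rewrite exprS -2![leRHS]mulrA.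
apply: (@norm_nfdiffS_le h n _ (fun s => w * (a%:R * logmon a b.+1 w p s -
    b%:R * logmon a.+1 b w p s))) => // s; first exact: is_derive_logmon.
rewrite nfdiffZ normrM; apply: ler_wpM2l => //.
rewrite nfdiffB !nfdiffZ.
apply: (@le_trans _ _ ((a + b)%:R * (h * `|w| * N%:R) ^+ n)); last first.
  apply: ler_wpM2r; first by rewrite exprn_ge0 ?mulr_ge0.
  by rewrite ler_nat; lia.
apply: le_trans (ler_normB _ _) _; rewrite natrD mulrDl !normrM !normr_nat.
by apply: lerD; apply: ler_wpM2l => //; apply: ih; lia.
Qed.

Lemma norm_nfdiff_logistic_le1 h n (w p t : R) : 0 <= h ->
  h * `|w| * n.+1%:R <= 1 ->
  `|nfdiff h n (fun t => logistic (w * t + p)) t| <= 1.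
Proof.
move=> h0 hw; rewrite (_ : nfdiff _ _ _ _ = nfdiff h n (logmon 1 0 w p) t); last first.
  by apply: eq_nfdiff => s; rewrite /logmon expr1 expr0 mulr1.
apply: le_trans (norm_nfdiff_logmon_le _ _ _ h0 (leqnn _)) _.
by rewrite exprn_ile1 ?mulr_ge0.
Qed.

End finite_differences.

(** * A lacunary Barron function *)

Section nonnegative_charges.
Context dT (T : measurableType dT) (R : realType).
Implicit Types (m : {finite_measure set T -> \bar R}).

(** For a nonnegative charge the negative set is null, whichever Hahn decomposition was chosen. *)
Lemma jordan_measure m (P N : set T)
    (nuPN : hahn_decomposition (charge_of_finite_measure m) P N) (A : set T) :
  measurable A -> jordan_pos nuPN A = m A /\ jordan_neg nuPN A = 0%E.
Proof.
move=> mA; have [[mP _] [mN negN] PNT PN0] := nuPN.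
have N0 : m (A `&` N) = 0%E.
  apply/eqP; rewrite eq_le measure_ge0 andbT.
  by apply: negN; [exact: measurableI|exact: subIsetr].
split.
  rewrite jordan_posE cjordan_posE /crestr0 mem_set//= /crestr /charge_of_finite_measure.
  have U : m ((A `&` P) `|` (A `&` N)) = (m (A `&` P) + m (A `&` N))%E.
    apply: measureU; [exact: measurableI|exact: measurableI|].
    by rewrite setIACA PN0 setI0.
  by rewrite N0 adde0 -setIUr PNT setIT in U; rewrite U.
rewrite jordan_negE cjordan_negE /crestr0 mem_set//=.
by rewrite /crestr /charge_of_finite_measure N0// oppe0.
Qed.

Lemma charge_integral_measure m (g : T -> R) :
  charge_integral (charge_of_finite_measure m) g = \int[m]_x g x.
Proof.
rewrite /charge_integral [X in _ - X](_ : _ = 0); last first.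
  rewrite /Rintegral (eq_measure_integral mzero) ?integral_measure_zero//.
  by move=> A mA _; exact: (jordan_measure _ mA).2.
rewrite subr0 /Rintegral; congr fine; apply: eq_measure_integral => A mA _.
exact: (jordan_measure _ mA).1.
Qed.

Lemma is_magnitude_measure m :
  is_magnitude (ComplexMeasure (charge_of_finite_measure m)
    (charge_of_finite_measure (@mzero dT T R))) m.
Proof.
have cmodE A : measurable A -> (cmodulus (ComplexMeasure (charge_of_finite_measure m)
    (charge_of_finite_measure (@mzero dT T R))) A)%:E = m A.
  move=> mA; rewrite /cmodulus /= /charge_of_finite_measure /mzero /= expr0n /= addr0.
  by rewrite sqrtr_sqr ger0_norm ?fine_ge0// fineK// fin_num_measure.
move=> A mA; apply/eqP; rewrite eq_le; apply/andP; split.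
  apply: ereal_sup_ubound; exists (fun n => if n is 0%N then A else set0).
    split; first by case.
      by apply/trivIsetP => -[|i] [|j] _ _ //=; rewrite ?setI0 ?set0I.
    by apply/seteqP; split => [x [[|n] _]//|x Ax]; exists 0%N.
  rewrite (nneseries_split 0 1)//; last by move=> k _; rewrite lee_fin sqrtr_ge0.
  rewrite add0n big_nat1 cmodE// eseries0 ?adde0// => -[|k]// _ _.
  by rewrite cmodE// measure0.
apply: ge_ereal_sup => _ [E [mE tE <-] <-].
rewrite (eq_eseriesr (g := fun n => m (E n))); last by move=> n _; rewrite cmodE.
by rewrite (measure_semi_bigcup _ mE tE)//; exact: bigcup_measurable.
Qed.

End nonnegative_charges.

Section lacunary_measure.
Context {R : realType} {d : nat}.
Implicit Types (x : euclid R d.+1).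

Definition axis (s : R) : euclid R d.+1 :=
  [tuple if j == ord0 then s else 0 : R | j < d.+1].

Lemma dot_axis s x : dot (axis s) x = s * (tnth x ord0 : R).
Proof.
rewrite /dot (bigD1 ord0)//= tnth_mktuple eqxx big1 ?addr0// => j j0.
by rewrite tnth_mktuple (negbTE j0) mul0r.
Qed.

Lemma cube_norm_axis s : cube_norm (axis s) = `|s|.
Proof.
have h (e : R) : \sum_(j < d.+1) Num.max (e * (tnth (axis s) j : R)) 0 = Num.max (e * s) 0.
  rewrite (bigD1 ord0)//= tnth_mktuple eqxx big1 ?addr0// => j j0.
  by rewrite tnth_mktuple (negbTE j0) mulr0 maxxx.
rewrite /cube_norm; under eq_bigr do rewrite -[tnth _ _]mul1r.
under [X in Num.max _ X]eq_bigr do rewrite -mulN1r.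
rewrite !h mul1r mulN1r; have [s0|s0] := leP 0 s.
  by rewrite (max_r (x := - s)) ?oppr_le0// max_l ?ger0_norm.
by rewrite (max_l (x := - s)) ?oppr_ge0 ?(ltW s0)// max_r ?ltr0_norm// oppr_ge0 ltW.
Qed.

Context (a : {nonneg R}).

(** Against frequencies of order 4^n the first moment is a geometric series of ratio 1/4, while the
    term M still has size h^2 for h = 4^(-M). *)
Definition lacunary_amp (n : nat) : {nonneg R} := (a%:num * 16 ^- n)%:nng.

(** A step 4^(-M) turns the phase by pi for n = M, by a multiple of 2 pi for n > M, and by at most
    pi / 4 <= 1 for n < M. *)
Definition lacunary_freq (n : nat) : R := pi * 4 ^+ n.

(* The atoms are symmetric, so that the Fourier transform is real. *)
Definition lacunary_atoms (n : nat) : {measure set (euclid R d.+1) -> \bar R} :=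
  measure_add (mscale (lacunary_amp n) \d_(axis (lacunary_freq n)))
    (mscale (lacunary_amp n) \d_(axis (- lacunary_freq n))).

Definition lacunary_measure : set (euclid R d.+1) -> \bar R :=
  mseries lacunary_atoms 0.

HB.instance Definition _ := Measure.on lacunary_measure.

Lemma ge0_integral_lacunary (g : euclid R d.+1 -> R) : measurable_fun setT g ->
  (forall w, 0 <= g w) ->
  (\int[lacunary_measure]_w (g w)%:E = \sum_(n <oo) ((lacunary_amp n)%:num *
     (g (axis (lacunary_freq n)) + g (axis (- lacunary_freq n))))%:E)%E.
Proof.
move=> mg g0; have mg' : measurable_fun setT (EFin \o g) by exact/measurable_EFinP.
rewrite ge0_integral_measure_series//; last by move=> w _; rewrite lee_fin.
apply: eq_eseriesr => n _; rewrite ge0_integral_measure_add//; last by move=> w _; rewrite lee_fin.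
rewrite !ge0_integral_mscale//; try by move=> w _; rewrite lee_fin.
by rewrite !integral_dirac// !diracT !mul1e mulrDr EFinD !EFinM.
Qed.

Lemma geometric_sum_le (K : R) (u : nat -> R) (N : nat) :
  (forall n, 0 <= u n <= K * 2 ^- n) -> \sum_(0 <= n < N) u n <= 2 * K.
Proof.
move=> hu; have K0 : 0 <= K.
  by have /andP[h1 h2] := hu 0%N; apply: le_trans h1 _; rewrite expr0 invr1 mulr1 in h2.
suff : \sum_(0 <= n < N) u n <= 2 * K - 2 * K * 2 ^- N.
  by move/le_trans; apply; rewrite gerBl !mulr_ge0 ?invr_ge0 ?exprn_ge0.
elim: N => [|N ih]; first by rewrite big_geq// expr0 invr1 mulr1 subrr.
rewrite big_nat_recr//=; apply: le_trans (lerD ih (proj2 (andP (hu N)))) _.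
by rewrite le_eqVlt; apply/orP; left; apply/eqP; rewrite exprS; field; rewrite expf_neq0.
Qed.

Lemma geometric_series_le (K : R) (u : nat -> R) : (forall n, 0 <= u n <= K * 2 ^- n) ->
  (\sum_(n <oo) (u n)%:E <= (2 * K)%:E)%E.
Proof.
move=> hu; apply: lime_le.
  by apply: is_cvg_nneseries => n _ _; rewrite lee_fin; case/andP: (hu n).
by apply: nearW => N; rewrite sumEFin lee_fin; exact: geometric_sum_le.
Qed.

Lemma lacunary_amp_le (n : nat) :
  0 <= 2 * (lacunary_amp n)%:num <= 2 * a%:num * 2 ^- n.
Proof.
rewrite /= !mulr_ge0 ?invr_ge0 ?exprn_ge0//= mulrA ler_wpM2l ?mulr_ge0//.
by rewrite lef_pV2 ?posrE ?exprn_gt0// lerXn2r ?nnegrE// ler_nat.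
Qed.

Lemma lacunary_mass : (lacunary_measure setT <= (4 * a%:num)%:E)%E.
Proof.
have <- : (\int[lacunary_measure]_w 1%:E = lacunary_measure setT)%E.
  by rewrite integral_cst// mul1e.
rewrite (@ge0_integral_lacunary (cst 1))//.
apply: le_trans (geometric_series_le (K := 2 * a%:num) _) _; last first.
  by rewrite lee_fin; lra.
by move=> n; rewrite -[1 + 1]/(2 : R) mulrC lacunary_amp_le.
Qed.

Lemma lacunary_finite : fin_num_fun lacunary_measure.
Proof.
apply: lty_fin_num_fun; apply: le_lt_trans lacunary_mass _; exact: ltry.
Qed.

HB.instance Definition _ := Measure_isFinite.Build _ _ _ lacunary_measure lacunary_finite.

Definition lacunary_fun x : R := \int[lacunary_measure]_w cos (dot w x).

Lemma integrable_cos_dot x : lacunary_measure.-integrable setT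
  (EFin \o (fun w : euclid R d.+1 => cos (dot w x))).
Proof.
apply: (@bounded_integrable _ _ _ _ _ 1); first exact: measurable_cos_dot.
by move=> u; exact: cos_max.
Qed.

(** The series formula requires nonnegative integrands, hence the detour through 1 + sin; symmetric
    atoms cancel the sines. *)
Lemma lacunary_sin x : \int[lacunary_measure]_w sin (dot w x) = 0.
Proof.
have ms := measurable_sin_dot x.
have is1 : lacunary_measure.-integrable setT
  (EFin \o (fun w : euclid R d.+1 => sin (dot w x))).
  apply: (@bounded_integrable _ _ _ _ _ 1) => //.
  by move=> u; exact: sin_max.
have i1 : lacunary_measure.-integrable setT (EFin \o (fun _ : euclid R d.+1 => 1 : R)).
  by apply: (@bounded_integrable _ _ _ _ _ 1) => // u; rewrite normr1.
have e : \int[lacunary_measure]_w (1 + sin (dot w x)) = \int[lacunary_measure]_w 1.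
  congr fine; rewrite !ge0_integral_lacunary//.
  - apply: eq_eseriesr => n _; congr ((_ * _)%:E).
    by rewrite !dot_axis mulNr sinN; ring.
  - exact: measurable_funD.
have := RintegralD measurableT i1 is1; rewrite e => /esym h.
by apply: (addrI (\int[lacunary_measure]_w 1)); rewrite addr0.
Qed.

(* For a step [h] that is a period of all frequencies beyond [M], differences of
   [rho] vanish. *)
Lemma lacunary_split (M : nat) : exists rho : R -> R,
  (forall x, lacunary_fun x = \sum_(0 <= n < M) 2 * (lacunary_amp n)%:num *
      cos (lacunary_freq n * (tnth x ord0 : R)) + rho (tnth x ord0)) /\
  (forall t h, (forall n, (M <= n)%N ->
      cos (lacunary_freq n * (t + h)) = cos (lacunary_freq n * t)) ->
    rho (t + h) = rho t).
Proof.
pose term n (t : R) : \bar R :=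
  (2 * (lacunary_amp n)%:num * (1 + cos (lacunary_freq n * t)))%:E.
pose tail t : \bar R := (\sum_(M <= n <oo) term n t)%E.
(* The terms use 1 + cos to be nonnegative; the two constants remove the contribution of the
   ones. *)
exists (fun t => fine (tail t) + \sum_(0 <= n < M) 2 * (lacunary_amp n)%:num -
  fine (lacunary_measure setT)); split; last first.
  move=> t h hM; congr (fine _ + _ - _); apply/congr_lim/funext => N.
  by apply: eq_big_nat => n /andP[Mn _]; rewrite /term hM.
move=> x; set t : R := tnth x ord0.
have i1 : lacunary_measure.-integrable setT (EFin \o (fun _ : euclid R d.+1 => 1 : R)).
  by apply: (@bounded_integrable _ _ _ _ _ 1) => // u; rewrite normr1.
have -> : lacunary_fun x = \int[lacunary_measure]_w (1 + cos (dot w x)) -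
    fine (lacunary_measure setT).
  rewrite RintegralD//; last exact: integrable_cos_dot.
  by rewrite Rintegral_cst// mul1r addrC addKr.
have term0 n : (0 <= term n t)%E.
  rewrite lee_fin !mulr_ge0// -lerBlDl sub0r; exact: cos_geN1.
have E : (\int[lacunary_measure]_w (1 + cos (dot w x))%:E =
    (\sum_(0 <= n < M) 2 * (lacunary_amp n)%:num * (1 + cos (lacunary_freq n * t)))%:E
      + tail t)%E.
  rewrite ge0_integral_lacunary; last 2 first.
  - apply: measurable_funD => //; exact: measurable_cos_dot.
  - by move=> w; rewrite -lerBlDl sub0r cos_geN1.
  rewrite (eq_eseriesr (g := term ^~ t)).
    by rewrite (nneseries_split 0 M)//= add0n sumEFin.
  move=> n _; congr (_%:E); rewrite !dot_axis mulNr cosN; ring.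
have tailfin : tail t \is a fin_num.
  rewrite ge0_fin_numE; last exact: nneseries_ge0.
  apply: (@le_lt_trans _ _ (\int[lacunary_measure]_w (1 + cos (dot w x))%:E)%E).
    rewrite E leeDr// lee_fin; apply: sumr_ge0 => n _.
    by have := term0 n; rewrite lee_fin.
  have : lacunary_measure.-integrable setT
      (EFin \o (fun w : euclid R d.+1 => 1 + cos (dot w x))).
    apply: (@bounded_integrable _ _ _ _ _ 2) => [|w].
      by apply: measurable_funD => //; exact: measurable_cos_dot.
    apply: le_trans (ler_normD _ _) _; rewrite normr1 [leRHS]mulr2n lerD2l.
    exact: cos_max.
  by move=> /(integrable_fin_num measurableT); rewrite fin_numElt => /andP[].
rewrite /Rintegral E fineD//=; under eq_bigr do rewrite mulrDr mulr1.
rewrite big_split /=; ring.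
Qed.

End lacunary_measure.

Section lacunary_barron.
Context {R : realType} {d : nat} (a : {nonneg R}).
Implicit Types (x : euclid R d.+1).
Local Notation nu := (@lacunary_measure R d a).

Lemma pi_le4 : pi <= 4 :> R.
Proof. by have := @pihalf_lt2 R; lra. Qed.

Lemma integral_cube_norm_lacunary :
  (\int[nu]_w (cube_norm w)%:E <= (16 * a%:num)%:E)%E.
Proof.
rewrite ge0_integral_lacunary; [|exact: measurable_cube_norm|exact: cube_norm_ge0].
apply: le_trans (geometric_series_le (K := 8 * a%:num) _) _; last first.
  by rewrite lee_fin; lra.
move=> n; rewrite !cube_norm_axis normrN ger0_norm; last first.
  by rewrite mulr_ge0 ?pi_ge0 ?exprn_ge0.
have f0 : 0 <= @lacunary_freq R n by rewrite mulr_ge0 ?pi_ge0 ?exprn_ge0.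
rewrite mulr_ge0 ?addr_ge0//= /lacunary_freq.
have e4 : (16 : R) ^+ n = 4 ^+ n * 4 ^+ n by rewrite -exprMn; congr (_ ^+ _); ring.
have -> : a%:num * 16 ^- n * (pi * 4 ^+ n + pi * 4 ^+ n) = (a%:num * 4 ^- n) * (2 * pi).
  by rewrite e4; field; rewrite expf_neq0.
have -> : 8 * a%:num * 2 ^- n = (a%:num * 2 ^- n) * (2 * 4) by ring.
apply: ler_pM => //; last by rewrite ler_wpM2l// pi_le4.
  by rewrite mulr_ge0// pi_ge0.
rewrite ler_wpM2l// lef_pV2 ?posrE ?exprn_gt0//.
by rewrite lerXn2r ?nnegrE// ler_nat.
Qed.

Lemma lacunary_barron_class : barron_class (16 * a%:num) (@lacunary_fun R d a).
Proof.
exists (ComplexMeasure (charge_of_finite_measure nu) (charge_of_finite_measure mzero)), nu.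
have int0 (g : euclid R d.+1 -> R) : \int[mzero]_w g w = 0.
  by rewrite /Rintegral integral_measure_zero.
split.
- move=> x; rewrite !charge_integral_measure /= !int0 subr0 addr0; split => //.
  by rewrite lacunary_sin.
- exact: is_magnitude_measure.
- rewrite ge_max; apply/andP; split.
    under eq_integral do rewrite dual_normE.
    exact: integral_cube_norm_lacunary.
  rewrite lee_fin /lacunary_fun; under eq_Rintegral do rewrite dot_origin cos0.
  rewrite Rintegral_cst// mul1r ger0_norm ?fine_ge0//.
  rewrite -lee_fin fineK ?fin_num_measure//; apply: le_trans (lacunary_mass _) _.
  by rewrite lee_fin ler_wpM2r// ler_nat.
Qed.

(** By [lacunary_split] with M = 0 the function depends on the first coordinate only, and it is
    Lipschitz there, with constant the first moment of the measure. *)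
Lemma measurable_lacunary_fun : measurable_fun setT (@lacunary_fun R d a).
Proof.
have [Phi [PhiE _]] := lacunary_split a 0 (d := d).
have PhiE' x : lacunary_fun a x = Phi (tnth x ord0).
  by rewrite PhiE big_geq// add0r.
have -> : lacunary_fun a = Phi \o (fun x : euclid R d.+1 => tnth x ord0 : R).
  by apply/funext => x; rewrite PhiE'.
apply: measurableT_comp; last exact: measurable_tnthR.
have PhiI t : Phi t = \int[nu]_w cos (dot w (axis t)).
  by have := PhiE' (axis t); rewrite tnth_mktuple eqxx => <-.
have lip t s : `|Phi t - Phi s| <= 16 * a%:num * `|t - s|.
  rewrite !PhiI -RintegralB//; [|exact: integrable_cos_dot|exact: integrable_cos_dot].
  have iN : nu.-integrable setT (EFin \o (cube_norm : euclid R d.+1 -> R)).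
    apply/integrableP; split; first by apply/measurable_EFinP; exact: measurable_cube_norm.
    apply: le_lt_trans (ltry (16 * a%:num)).
    under eq_integral do rewrite /= ger0_norm ?cube_norm_ge0//.
    exact: integral_cube_norm_lacunary.
  have iB : nu.-integrable setT (EFin \o (fun w : euclid R d.+1 =>
      cos (dot w (axis t)) - cos (dot w (axis s)))).
    apply: (@bounded_integrable _ _ _ _ _ 2) => [|w].
      by apply: measurable_funB; exact: measurable_cos_dot.
    apply: le_trans (ler_normB _ _) _; rewrite [leRHS]mulr2n; apply: lerD; exact: cos_max.
  apply: le_trans (le_normr_Rintegral measurableT iB) _.
  apply: (@le_trans _ _ (\int[nu]_w (cube_norm w * `|t - s|))).
    apply: le_Rintegral => //.
    - exact: (integrable_abse iB).
    - have -> : EFin \o (fun w : euclid R d.+1 => cube_norm w * `|t - s|) =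
          (fun w => (cube_norm w)%:E * `|t - s|%:E)%E.
        by apply/funext => w; rewrite /= EFinM.
      exact: integrableZr.
    - move=> w _; apply: le_trans (norm_cos_sub_le _ _) _.
      rewrite !(dotC w) !dot_axis -mulrBl normrM mulrC.
      by rewrite ler_wpM2r// norm_tnth_le.
  rewrite RintegralZr// ler_wpM2r// -lee_fin /Rintegral fineK.
    exact: integral_cube_norm_lacunary.
  exact: integrable_fin_num.
apply: continuous_measurable_fun => t; apply/cvgrPdist_le => e e0.
have L0 : 0 < 16 * a%:num + 1 by rewrite ltr_wpDl.
near=> s; apply: le_trans (lip t s) _.
apply: (@le_trans _ _ ((16 * a%:num + 1) * `|t - s|)).
  by rewrite ler_wpM2r// lerDl.
rewrite -ler_pdivlMl// mulrC; near: s; apply: (@cvgr_dist_le _ _ _ (nbhs t) _ id t) => //.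
by rewrite divr_gt0.
Unshelve. all: by end_near.
Qed.

End lacunary_barron.

(** * The lower bound *)

Section lebesgue_translation.
Context {R : realType}.
Local Notation leb := (@lebesgue_measure R).

Lemma lebesgue_translate (c : R) (E : set (measurableTypeR R)) : measurable E ->
  leb [set t | E (t + c)] = leb E.
Proof.
move=> mE.
have mf : measurable_fun setT (fun t : measurableTypeR R => (t + c : measurableTypeR R)).
  exact: measurable_funD.
pose mu := pushforward leb (fun t : measurableTypeR R => (t + c : measurableTypeR R)).
apply/esym; rewrite -[RHS]/(mu E).
apply: (@lebesgue_measure_unique _ mu) => // X [[u v] _ <-].
transitivity (leb (`](u - c), (v - c)]%classic : set (measurableTypeR R))); last first.
  congr leb; apply/esym; apply/seteqP; split=> t /=; rewrite !in_itv /= => /andP[h1 h2].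
    by apply/andP; split; [rewrite ltrBlDr|rewrite lerBrDr].
  by apply/andP; split; [rewrite -ltrBlDr|rewrite -lerBrDr].
rewrite !lebesgue_measure_itv /= !lte_fin ltrD2r; case: ifP => // _.
by rewrite -!EFinB; congr (_%:E); ring.
Qed.

(** Union bound over n + 1 translates of the same measure: a gap at some translate of every t
    becomes a gap on a set of definite length. *)
Lemma translates_cover (E : set (measurableTypeR R)) (h p : R) (n : nat) :
  measurable E -> 0 <= p ->
  (forall t, 0 <= t <= p -> exists2 j, (j <= n)%N & E (t + j%:R * h)) ->
  (p%:E <= n.+1%:R%:E * leb E)%E.
Proof.
move=> mE p0 cov.
pose A (j : nat) : set (measurableTypeR R) := [set t | E (t + j%:R * h)].
have mA j : measurable (A j).
  have mf : measurable_fun setT (fun t : measurableTypeR R => (t + j%:R * h : measurableTypeR R)).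
    exact: measurable_funD.
  by rewrite -[A j]setTI; exact: mf.
have -> : p%:E = leb (`[0, p]%classic : set (measurableTypeR R)).
  rewrite lebesgue_measure_itv /= lte_fin; case: ltP => [_|p0'].
    by rewrite sube0.
  by congr (_%:E); apply/eqP; rewrite eq_le p0' p0.
apply: (@le_trans _ _ (leb (\big[setU/set0]_(j < n.+1) A j))).
  apply: le_measure; rewrite ?inE; [exact: measurable_itv| |].
    by apply: bigsetU_measurable => j _; exact: mA.
  move=> t /=; rewrite in_itv /= => /cov[j jn Ej].
  by rewrite -bigcup_mkord; exists j.
apply: le_trans (Boole_inequality leb (A := A) _) _ => //.
rewrite (eq_bigr (fun=> leb E)); last by move=> j _; exact: lebesgue_translate.
by rewrite mule_natl sumr_const card_ord.
Qed.

End lebesgue_translation.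

Section cube_measure.
Context {R : realType}.

Lemma cons_pair_cube (d : nat) : @cons_pair R d @^-1` unit_cube d.+1 =
  unit_cube d `*` `[0, 1]%classic.
Proof.
apply/seteqP; split => [[x t] /= h|[x t] /= [hx] ht j].
  split => [j|]; last by have := h ord0; rewrite in_itv /cons_pair /= (tnth_nth 0).
  by have := h (lift ord0 j); rewrite /cons_pair !(tnth_nth 0).
have [->|[i ->]] : j = ord0 \/ exists i, j = lift ord0 i.
  by case: (unliftP ord0 j) => [i ->|->]; [right; exists i|left].
  by rewrite in_itv /= in ht; rewrite /cons_pair (tnth_nth 0).
by have := hx i; rewrite /cons_pair !(tnth_nth 0).
Qed.

Lemma lebesgue_unit_cube (d : nat) : lebesgue_euclid d (unit_cube d) = 1%E :> \bar R.
Proof.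
elim: d => [|d ih].
  rewrite /= diracE mem_set// => j; by case: j.
rewrite /= /lebesgue_cons /pushforward cons_pair_cube product_measure1E.
- have L : lebesgue_measure (`[0, 1]%classic : set (measurableTypeR R)) = 1%E.
    by rewrite lebesgue_measure_itv /= lte_fin ltr01 sube0.
  by rewrite ih mul1e; exact: L.
- exact: measurable_unit_cube.
- exact: measurable_itv.
Qed.

(** Fubini along the first coordinate, which is the factor added by [cons_pair]; the base has
    measure 1. *)
Lemma measure_sections_ge (d : nat) (E : set (euclid R d.+1)) (p : R) :
  measurable E -> 0 <= p ->
  (forall x, unit_cube d x ->
    (p%:E <= lebesgue_measure [set t : measurableTypeR R | E (cons_pair (x, t))])%E) ->
  (p%:E <= lebesgue_euclid d.+1 E)%E.
Proof.
move=> mE p0 hE.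
have mpre : measurable (@cons_pair R d @^-1` E).
  by rewrite -[X in measurable X]setTI; exact: measurable_cons_pair.
rewrite /= /lebesgue_cons /pushforward /product_measure1.
have mc := @measurable_unit_cube R d.
apply: (@le_trans _ _ (\int[lebesgue_euclid d]_x (p * \1_(unit_cube d) x)%:E)%E).
  under eq_integral do rewrite EFinM.
  rewrite integralZl_indic//; last by move=> /lt_geF; rewrite p0.
  by rewrite integral_indic// setIT lebesgue_unit_cube mule1.
apply: ge0_le_integral => //.
- by move=> x _; rewrite lee_fin mulr_ge0// indicE.
- by apply/measurable_EFinP; apply: measurable_funM.
- exact: measurable_fun_xsection.
move=> x _; have [cx|cx] := pselect (unit_cube d x).
  rewrite indicE mem_set// mulr1 /=; apply: le_trans (hE x cx) _.
  rewrite (_ : xsection _ _ = [set t | E (cons_pair (x, t))])//.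
  by apply/seteqP; split => t; rewrite /xsection /= inE.
by rewrite indicE memNset// mulr0.
Qed.

Lemma measurable_norm_ge (d : nat) (F : euclid R d -> R) (kappa : R) :
  measurable_fun setT F -> measurable [set x | kappa <= `|F x|].
Proof.
move=> mF; have mN : measurable_fun setT (fun x => `|F x|) by exact: measurableT_comp.
rewrite (_ : [set x | kappa <= `|F x|] =
    setT `&` (fun x => `|F x|) @^-1` `[kappa, +oo[%classic).
  by apply: mN => //; exact: measurable_itv.
by rewrite setTI; apply/seteqP; split=> x /=; rewrite in_itv/= andbT.
Qed.

(** Chebyshev's inequality for F^2. *)
Lemma L2_norm_cube_ge (d : nat) (F : euclid R d -> R) (kappa p : R) :
  measurable_fun setT F -> 0 <= kappa -> 0 <= p ->
  (p%:E <= lebesgue_euclid d ([set x | (kappa <= `|F x|)%R] `&` unit_cube d))%E ->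
  ((kappa * Num.sqrt p)%:E <= L2_norm_cube F)%E.
Proof.
move=> mF k0 p0 hp; rewrite /L2_norm_cube Lnorm.unlock.
set mu := mrestr _ _.
have mE := measurable_norm_ge kappa mF.
have FE x : (`|(EFin \o F) x| `^ 2)%E = (`|F x| `^ 2)%:E by rewrite -poweR_EFin.
have low : ((kappa ^+ 2 * p)%:E <= \int[mu]_x `|(EFin \o F) x| `^ 2)%E.
  apply: (@le_trans _ _ (\int[mu]_x (kappa ^+ 2 * \1_[set x | (kappa <= `|F x|)%R] x)%:E)%E).
    under eq_integral do rewrite EFinM.
    rewrite ge0_integralZl_EFin ?sqr_ge0//; last first.
      by apply/measurable_EFinP; exact: measurable_indic.
    by rewrite integral_indic// setIT EFinM lee_pmul// lee_fin ?sqr_ge0.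
  apply: ge0_le_integral => //.
  - by move=> x _; rewrite lee_fin mulr_ge0 ?sqr_ge0// indicE.
  - by apply/measurable_EFinP; apply: measurable_funM.
  - under eq_fun do rewrite FE.
    apply/measurable_EFinP; apply: (measurableT_comp (measurable_powR _)).
    exact: measurableT_comp.
  move=> x _; rewrite FE lee_fin powR_mulrn//.
  have [h|h] := pselect (kappa <= `|F x|).
    by rewrite indicE mem_set// mulr1 lerXn2r ?nnegrE.
  by rewrite indicE memNset// mulr0 sqr_ge0.
have -> : (kappa * Num.sqrt p)%:E = ((kappa ^+ 2 * p)%:E `^ 2^-1)%E.
  rewrite poweR_EFin powR12_sqrt; last by rewrite mulr_ge0 ?sqr_ge0.
  by rewrite sqrtrM ?sqr_ge0// sqrtr_sqr ger0_norm.
apply: gt0_ler_poweR => //.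
- by rewrite in_itv/= lee_fin mulr_ge0 ?sqr_ge0// leey.
- by rewrite in_itv/= leey andbT; apply: integral_ge0 => x _; rewrite lee_fin powR_ge0.
Qed.

End cube_measure.

Section lower_bound.
Context {R : realType} {d : nat}.

Lemma tnth_cons_pair0 (y : euclid R d) (t : R) : tnth (cons_pair (y, t)) ord0 = t.
Proof. by rewrite /cons_pair (tnth_nth 0). Qed.

Lemma dot_cons_pair (w : euclid R d.+1) (y : euclid R d) : exists p : R,
  forall t : R, dot w (cons_pair (y, t)) = (tnth w ord0 : R) * t + p.
Proof.
exists (\sum_(j < d) (tnth w (lift ord0 j) : R) * tnth y j) => t.
rewrite /dot big_ord_recl tnth_cons_pair0; congr (_ + _).
by apply: eq_bigr => j _; rewrite /cons_pair !(tnth_nth 0).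
Qed.

Lemma measurable_logistic : measurable_fun setT (@logistic R).
Proof.
apply: continuous_measurable_fun => t; apply: differentiable_continuous.
by apply/derivable1_diffP; have [] := is_derive_logistic t.
Qed.

Lemma measurable_shallow_nets (m k : nat) (a1 a2 a3 : R) (g : euclid R m -> R) :
  shallow_nets k a1 a2 a3 g -> measurable_fun setT g.
Proof.
move=> [be [w [b [b0 [gE _ _ _]]]]].
have -> : g = fun x => \sum_(i < k) be i * logistic (dot (w i) x + b i) + b0.
  exact/funext.
apply: measurable_funD => //; apply: measurable_sum => i.
apply: measurable_funM => //; apply: (measurableT_comp measurable_logistic).
apply: measurable_funD => //.
apply: (eq_measurable_fun (fun x => dot x (w i))) => [x _|]; first exact: dotC.
exact: measurable_dot.
Qed.

(** At least one difference is taken, which removes [b0]; along the line each unit is a logistic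
    function of slope at most [a1], and its differences stay below 1. *)
Lemma norm_nfdiff_net_le (k n : nat) (a1 a2 a3 h t : R) (g : euclid R d.+1 -> R)
    (y : euclid R d) :
  shallow_nets k a1 a2 a3 g -> 0 <= h -> h * a1 * n.+2%:R <= 1 ->
  `|nfdiff h n.+1 (fun t => g (cons_pair (y, t))) t| <= k%:R * a2.
Proof.
move=> [be [w [b [b0 [gE wb beb _]]]]] h0 ha.
pose c i : R := projT1 (cid (dot_cons_pair (w i) y)) + b i.
have gE' s : g (cons_pair (y, s)) =
    (\sum_(i < k) be i * logistic ((tnth (w i) ord0 : R) * s + c i)) + b0.
  rewrite gE; congr (_ + _); apply: eq_bigr => i _; congr (_ * logistic _).
  by rewrite /c; case: (cid _) => p /= ->; rewrite addrA.
rewrite (eq_nfdiff _ _ _ gE') nfdiffD (nfdiff_periodic _ _ (u := fun=> b0))// addr0.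
rewrite nfdiff_sum; apply: le_trans (ler_norm_sum _ _ _) _.
apply: (@le_trans _ _ (\sum_(i < k) a2)); last by rewrite sumr_const card_ord mulr_natl.
apply: ler_sum => i _; rewrite nfdiffZ normrM -[leRHS]mulr1; apply: ler_pM => //.
apply: norm_nfdiff_logistic_le1 => //; apply: le_trans ha.
by rewrite ler_wpM2r// ler_wpM2l//; have [] := wb i.
Qed.

Lemma lacunary_freq_step (M j : nat) (x : R) :
  cos (x + lacunary_freq (M + j).+1 * 4 ^- M) = cos x.
Proof.
have -> : lacunary_freq (M + j).+1 * 4 ^- M = (pi *+ 2) *+ (2 * 4 ^ j) :> R.
  rewrite /lacunary_freq exprS exprD -mulrnA -[RHS]mulr_natl !natrM natrX.
  by field; rewrite expf_neq0.
by rewrite (periodicn (@cosD2pi R)).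
Qed.

Lemma nfdiff_lacunary_ge (a : {nonneg R}) (M n : nat) (y : euclid R d) (t : R) :
  0 <= t <= 4 ^- M / 8 ->
  2 ^+ n.+1 * (a%:num * (4 ^- M) ^+ 2) - 4 * a%:num <=
  `|nfdiff (4 ^- M) n.+1 (fun t => lacunary_fun a (cons_pair (y, t))) t|.
Proof.
set h : R := 4 ^- M => /andP[t0 th]; have h0 : 0 < h by rewrite invr_gt0 exprn_gt0.
(* Split after the term [M]: the remainder has period h, and [M] is the last explicit term. *)
have [rho [fE per]] := lacunary_split (d := d) a M.+1.
have fE' s : lacunary_fun a (cons_pair (y, s)) =
  (\sum_(0 <= m < M) 2 * (lacunary_amp a m)%:num * cos (lacunary_freq m * s + 0)) +
   2 * (lacunary_amp a M)%:num * cos (lacunary_freq M * s + 0) + rho s.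
  rewrite fE tnth_cons_pair0 big_nat_recr//= addr0; congr (_ + _ + _).
  by apply: eq_bigr => m _; rewrite addr0.
rewrite (eq_nfdiff _ _ _ fE') !nfdiffD (nfdiff_periodic _ _ (u := rho)); last first.
  move=> s; apply: per => m Mm; rewrite mulrDr.
  by rewrite -(subnKC Mm) addSn lacunary_freq_step.
rewrite addr0 nfdiff_sum nfdiffZ nfdiff_cos.
have freqh : lacunary_freq M * h = pi.
  by rewrite /lacunary_freq /h -mulrA mulfV ?mulr1// expf_neq0.
have pi2 : pi / 2 + pi / 2 = pi :> R by field.
rewrite freqh addr0 pi2 sin_pihalf mulr1.
(* The shifts by pi only change the sign, and t <= h / 8 keeps the phase below pi / 8 <= 1/2. *)
have cos_ge : 2^-1 <= `|cos (lacunary_freq M * t + n.+1%:R * pi)|.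
  rewrite mulr_natl (alternatingn (@cosDpi R)) normrMsign.
  have : `|cos (lacunary_freq M * t) - cos 0| <= 2^-1.
    apply: le_trans (norm_cos_sub_le _ _) _; rewrite subr0 ger0_norm; last first.
      by rewrite !mulr_ge0 ?pi_ge0 ?exprn_ge0.
    apply: (@le_trans _ _ (lacunary_freq M * (h / 8))).
      by rewrite ler_wpM2l// mulr_ge0 ?pi_ge0 ?exprn_ge0.
    by rewrite mulrA freqh; have := @pi_le4 R; lra.
  rewrite cos0 ler_norml => /andP[h1 _]; apply: le_trans (ler_norm _); lra.
have ampM : 2 * (lacunary_amp a M)%:num = 2 * (a%:num * h ^+ 2).
  rewrite /= /h -exprVn; congr (_ * (_ * _)).
  by rewrite -exprVn -exprM mulnC exprM; congr (_ ^+ _); field.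
have low : 2 ^+ n.+1 * (a%:num * h ^+ 2) <=
    `|2 * (lacunary_amp a M)%:num * (2 ^+ n.+1 * cos (lacunary_freq M * t + n.+1%:R * pi))|.
  have A0 : 0 <= 2 * (a%:num * h ^+ 2).
    by apply: mulr_ge0 => //; apply: mulr_ge0 => //; exact: sqr_ge0.
  have B0 : 0 <= 2 ^+ n.+1 :> R by rewrite exprn_ge0.
  rewrite ampM normrM (ger0_norm A0) normrM (ger0_norm B0).
  have -> : 2 ^+ n.+1 * (a%:num * h ^+ 2) = 2 * (a%:num * h ^+ 2) * (2 ^+ n.+1 * 2^-1).
    by field.
  by apply: ler_wpM2l => //; apply: ler_wpM2l.
have small : `|\sum_(0 <= m < M) nfdiff h n.+1 (fun s =>
    2 * (lacunary_amp a m)%:num * cos (lacunary_freq m * s + 0)) t| <= 4 * a%:num.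
  apply: le_trans (ler_norm_sum _ _ _) _.
  apply: (@le_trans _ _ (\sum_(0 <= m < M) 2 * (lacunary_amp a m)%:num)).
    apply: ler_sum_nat => m /andP[_ mM]; rewrite nfdiffZ normrM.
    have /andP[amp0 _] := lacunary_amp_le a m.
    rewrite (ger0_norm amp0) -[leRHS]mulr1 ler_wpM2l//.
    apply: norm_nfdiff_cos_le1; rewrite ger0_norm; last first.
      by rewrite !mulr_ge0 ?pi_ge0 ?exprn_ge0// ltW.
    rewrite /lacunary_freq /h -(subnK mM) exprD exprS.
    have -> : pi * 4 ^+ m * (4 ^+ (M - m.+1) * (4 * 4 ^+ m))^-1 =
        (pi / 4) * 4 ^- (M - m.+1) :> R by field; rewrite !expf_neq0.
    apply: mulr_ile1; rewrite ?divr_ge0 ?pi_ge0 ?invr_ge0 ?exprn_ge0//.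
      by have := @pi_le4 R; lra.
    by rewrite invf_le1 ?exprn_gt0// exprn_ege1// ler1n.
  have -> : 4 * a%:num = 2 * (2 * a%:num) by ring.
  apply: geometric_sum_le => m; exact: lacunary_amp_le.
move: low small; set A := 2 * _ * _; set B := \sum_(0 <= m < M) _ => low small.
have := lerB_normD A B; rewrite [A + B]addrC; lra.
Qed.

(** The differences of f reach twice 2^(n+1) kappa, up to 4 a. If f - g were below kappa at all
    translates, one half would be used up, and the other half exceeds k a_2 + 4 a by hypothesis. *)
Lemma gap_at_translate (a : {nonneg R}) (M n k : nat) (a1 a2 a3 : R)
    (g : euclid R d.+1 -> R) (y : euclid R d) (t : R) :
  let h := 4 ^- M in let kappa := a%:num * h ^+ 2 / 2 in
  shallow_nets k a1 a2 a3 g -> h * a1 * n.+2%:R <= 1 ->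
  k%:R * a2 + 4 * a%:num < 2 ^+ n.+1 * kappa -> 0 <= t <= h / 8 ->
  exists2 j, (j <= n.+1)%N & kappa <=
    `|lacunary_fun a (cons_pair (y, t + j%:R * h)) - g (cons_pair (y, t + j%:R * h))|.
Proof.
move=> h kappa gN ha big ht; apply: contrapT => nex.
have h0 : 0 <= h by rewrite invr_ge0 exprn_ge0.
have ub : `|nfdiff h n.+1 (fun t => lacunary_fun a (cons_pair (y, t)) -
    g (cons_pair (y, t))) t| <= 2 ^+ n.+1 * kappa.
  apply: norm_nfdiff_le => j jn; rewrite leNgt; apply/negP => lt.
  by apply: nex; exists j => //; exact: ltW.
have := nfdiff_lacunary_ge a n y ht; rewrite -/h.
have := norm_nfdiff_net_le t y gN h0 ha.
rewrite nfdiffB in ub; move: ub.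
set A := nfdiff _ _ _ _; set B := nfdiff _ _ _ _ => ub hB hA.
have := lerB_dist A B.
have e : 2 ^+ n.+1 * (a%:num * h ^+ 2) = 2 ^+ n.+1 * kappa + 2 ^+ n.+1 * kappa.
  by rewrite /kappa; field.
by move: big hA; rewrite e; set X := 2 ^+ n.+1 * kappa in ub *; lra.
Qed.

(** On each line along the first axis, n + 2 translates of the set where |f - g| >= kappa cover
    [0, h / 8]. The condition (n + 1) h <= 1/2 keeps the translated points in the cube. *)
Lemma L2_gap (a : {nonneg R}) (M n k : nat) (a1 a2 a3 : R) (g : euclid R d.+1 -> R) :
  let h := 4 ^- M in let kappa := a%:num * h ^+ 2 / 2 in
  shallow_nets k a1 a2 a3 g -> h * a1 * n.+2%:R <= 1 ->
  k%:R * a2 + 4 * a%:num < 2 ^+ n.+1 * kappa -> n.+1%:R * h <= 2^-1 ->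
  ((kappa * Num.sqrt (h / 8 / n.+2%:R))%:E <=
     L2_norm_cube (fun x => lacunary_fun a x - g x)%R)%E.
Proof.
move=> h kappa gN ha big nh.
have h0 : 0 < h by rewrite invr_gt0 exprn_gt0.
have h1 : h <= 1 by rewrite invf_le1 ?exprn_gt0// exprn_ege1// ler1n.
have kap0 : 0 <= kappa by rewrite divr_ge0 ?mulr_ge0 ?(ltW h0).
have mF : measurable_fun setT (fun x => lacunary_fun a x - g x).
  apply: measurable_funB; first exact: measurable_lacunary_fun.
  exact: measurable_shallow_nets gN.
have mE : measurable ([set x | kappa <= `|lacunary_fun a x - g x|] `&` unit_cube d.+1).
  apply: measurableI; last exact: measurable_unit_cube.
  exact: measurable_norm_ge.
apply: L2_norm_cube_ge => //; first by rewrite !divr_ge0 ?(ltW h0).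
apply: measure_sections_ge => //; first by rewrite !divr_ge0 ?(ltW h0).
move=> y cy; rewrite EFinM lee_pdivrMr ?ltr0n// muleC.
apply: (translates_cover (h := h)).
- rewrite -[X in measurable X]setTI.
  have mc : measurable_fun setT (fun t : measurableTypeR R => cons_pair (y, t)).
    exact: (measurableT_comp (@measurable_cons_pair R d) (pair1_measurable y)).
  exact: mc.
- by rewrite divr_ge0 ?(ltW h0).
move=> t /andP[t0 th].
have ht : 0 <= t <= 4 ^- M / 8 by rewrite t0.
have [j jn hj] := gap_at_translate y gN ha big ht; exists j => //; split => //=.
have jh : j%:R * h <= 2^-1.
  by apply: le_trans nh; rewrite ler_pM2r// ler_nat.
have jh0 : 0 <= j%:R * h by rewrite mulr_ge0 ?(ltW h0).
move=> i; have [->|[i' ->]] : i = ord0 \/ exists i', i = lift ord0 i'.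
    by case: (unliftP ord0 i) => [i' ->|->]; [right; exists i'|left].
  by rewrite tnth_cons_pair0; apply/andP; split; lra.
by have := cy i'; rewrite /cons_pair !(tnth_nth 0).
Qed.

End lower_bound.

Lemma lacunary_gap_eventually (R : realType) (d : nat) (a : {nonneg R})
    (a1 a2 a3 e : R) : 0 < a%:num -> 0 <= a1 -> 0 <= a2 -> 2^-1 <= e ->
  \forall k \near \oo, forall g : euclid R d.+1 -> R, shallow_nets k a1 a2 a3 g ->
    ((k%:R `^ (- e))%:E <= L2_norm_cube (fun x => lacunary_fun a x - g x)%R)%E.
Proof.
(* The step will be h = sg / N with N = n + 1 differences; this [s] ensures 2 a_1 sg <= 1 and sg <=
   1/2, whatever N. *)
move=> a0 a10 a20 e2; pose s := (Num.truncn (2 * a1)).+1; pose sg : R := 4 ^- s.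
have sg0 : 0 < sg by rewrite invr_gt0 exprn_gt0.
have expS m : (m <= 4 ^ m)%N by apply: ltnW; exact: ltn_expl.
have sga : 2 * a1 * sg <= 1.
  rewrite /sg ler_pdivrMr ?exprn_gt0// mul1r.
  have h0 : 0 <= 2 * a1 by rewrite mulr_ge0.
  have /andP[_ h1] := truncn_itv h0; apply: le_trans (ltW h1) _.
  by rewrite -natrX ler_nat expS.
have sg2 : sg <= 2^-1.
  rewrite /sg lef_pV2 ?posrE ?exprn_gt0// exprS; apply: (@le_trans _ _ (4 * 1)); first lra.
  by rewrite ler_pM2l// exprn_ege1// ler1n.
have ln2 : 0 < ln 2 :> R by rewrite ln_gt0// ltr1n.
(* As k < (4 N)^8 and 1 / kappa is a constant times N^2, it suffices that 2^N exceeds A N^10. *)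
pose A : R := (4 ^+ 8 * a2 + 4 * a%:num) * 2 / (a%:num * sg ^+ 2).
have [n0 hn0] := expR_gt_poly A 10 ln2.
(* The gap is at least N^(-3) / B, hence at least N^(-4) >= k^(-1/2) once B <= N. *)
pose B : R := 8 / (a%:num * sg ^+ 2 * Num.sqrt sg).
pose r0 := maxn n0 (Num.truncn B).+1.
near=> k => g gN.
have kr0 : ((4 ^ r0) ^ 8 <= k)%N by near: k; exact: nbhs_infty_ge.
have k0 : (0 < k)%N by apply: leq_trans kr0; rewrite !expn_gt0.
(* N = 4^r is the largest power of 4 with N^8 <= k; a power of 4 because h must be some 4^(-M). *)
have [r [rk kr rr0]] : exists r, [/\ ((4 ^ r) ^ 8 <= k)%N,
    (k < (4 ^ r.+1) ^ 8)%N & (r0 <= r)%N].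
  have ex : exists r, ((4 ^ r) ^ 8 <= k)%N by exists r0.
  have bnd m : ((4 ^ m) ^ 8 <= k)%N -> (m <= k)%N.
    apply: leq_trans; apply: leq_trans (expS m) _.
    by rewrite -{1}[(4 ^ m)%N]expn1 leq_pexp2l// expn_gt0.
  case: (ex_maxnP ex bnd) => r hr rmax; exists r; split => //; last exact: rmax.
  by rewrite ltnNge; apply/negP => /rmax; rewrite ltnn.
pose N := (4 ^ r)%N; have N0 : (0 < N)%N by rewrite expn_gt0.
have NR : 0 < N%:R :> R by rewrite ltr0n.
have rN : (r0 <= N)%N by apply: leq_trans rr0 (expS r).
have BN : B <= N%:R.
  have B0 : 0 <= B by rewrite divr_ge0 ?mulr_ge0 ?sqrtr_ge0 ?(ltW a0) ?exprn_ge0 ?(ltW sg0).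
  have /andP[_ h1] := truncn_itv B0; apply: le_trans (ltW h1) _.
  by rewrite ler_nat; apply: leq_trans rN; rewrite leq_maxr.
pose h : R := 4 ^- (r + s).
have hE : h = sg / N%:R by rewrite /h /sg /N exprD natrX invfM mulrC.
have N2 : N.+1%:R <= 2 * N%:R :> R by rewrite -natrM ler_nat mul2n -addnn -add1n leq_add2r.
have h0 : 0 < h by rewrite hE divr_gt0.
have kap0 : 0 < a%:num * h ^+ 2 / 2.
  by apply: divr_gt0 => //; apply: mulr_gt0 => //; exact: exprn_gt0.
have := @L2_gap R d a (r + s) N.-1 k a1 a2 a3 g.
rewrite prednK// -/h => /(_ gN) gap; apply: le_trans (gap _ _ _).
- rewrite lee_fin.
  have kR : 1 <= k%:R :> R by rewrite ler1n.
  have kN : k%:R `^ (- e) <= N%:R ^- 4.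
    apply: (@le_trans _ _ (k%:R `^ (- 2^-1))); first by rewrite ler_powR// lerN2.
    rewrite powRN powR12_sqrt ?ler0n// lef_pV2 ?posrE ?exprn_gt0 ?sqrtr_gt0 ?ltr0n//.
    rewrite -[leLHS]ger0_norm ?exprn_ge0// -sqrtr_sqr ler_sqrt ?ler0n//.
    by rewrite -exprM -natrX ler_nat.
  apply: le_trans kN _.
  have p1 : Num.sqrt sg / (4 * N%:R) <= Num.sqrt (h / 8 / N.+1%:R).
    have -> : Num.sqrt sg / (4 * N%:R) = Num.sqrt (sg * (4 * N%:R)^-1 ^+ 2).
      by rewrite sqrtrM ?(ltW sg0)// sqrtr_sqr ger0_norm// invr_ge0 mulr_ge0.
    rewrite ler_sqrt; last by rewrite !divr_ge0 ?hE ?divr_ge0 ?(ltW sg0).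
    have -> : h / 8 / N.+1%:R = sg * (8 * N%:R * N.+1%:R)^-1.
      by rewrite hE; field; rewrite !gt_eqF ?ltr0n.
    rewrite ler_pM2l// exprVn lef_pV2 ?posrE ?exprn_gt0 ?mulr_gt0 ?ltr0n//.
    have := ler_wpM2l (ltW NR) N2; set X := N%:R in NR *; set Y := N.+1%:R.
    by rewrite expr2; nra.
  apply: le_trans (ler_wpM2l _ p1); last exact: ltW.
  move: BN; rewrite /B ler_pdivrMr; last by rewrite !mulr_gt0 ?sqrtr_gt0 ?exprn_gt0.
  set q := Num.sqrt sg => BN.
  have -> : a%:num * h ^+ 2 / 2 * (q / (4 * N%:R)) = N%:R ^- 4 *
      (N%:R * (a%:num * sg ^+ 2 * q) / 8).
    by rewrite hE; field; rewrite gt_eqF.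
  by rewrite ler_pMr ?invr_gt0 ?exprn_gt0// ler_pdivlMr// mul1r.
- rewrite hE; apply: (@le_trans _ _ (sg / N%:R * a1 * (2 * N%:R))).
    by rewrite ler_wpM2l// mulr_ge0// divr_ge0 ?(ltW sg0).
  by rewrite (_ : _ * (2 * N%:R) = 2 * a1 * sg)//; field; rewrite gt_eqF.
- have hn := hn0 N (leq_trans (leq_maxl _ _) rN).
  have -> : 2 ^+ N = expR (ln 2 * N%:R) :> R by rewrite mulrC expRM_natl lnK ?posrE.
  apply: (@le_lt_trans _ _ (A * N.+1%:R ^+ 10 * (a%:num * h ^+ 2 / 2))); last by rewrite ltr_pM2r.
  apply: (@le_trans _ _ (A * N%:R ^+ 10 * (a%:num * h ^+ 2 / 2))); last first.
    rewrite ler_pM2r// ler_wpM2l//.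
      by rewrite /A !divr_ge0 ?mulr_ge0 ?addr_ge0 ?mulr_ge0 ?exprn_ge0 ?(ltW sg0).
    by rewrite lerXn2r ?nnegrE ?ler0n// ler_nat.
  have -> : A * N%:R ^+ 10 * (a%:num * h ^+ 2 / 2) = (4 ^+ 8 * a2 + 4 * a%:num) * N%:R ^+ 8.
    by rewrite /A hE; field; rewrite !gt_eqF.
  rewrite [leRHS]mulrDl; apply: lerD.
    rewrite mulrAC ler_wpM2r// -!natrX -natrM ler_nat -expnMn.
    by rewrite -expnS ltnW.
  by rewrite ler_peMr ?mulr_ge0 ?(ltW a0)// exprn_ege1// ler1n.
- by rewrite hE mulrC divfK ?gt_eqF.
Unshelve. all: by end_near.
Qed.

Lemma barron_lower_bound (R : realType) (d : nat) (a1 a2 a3 c e : R) :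
  0 <= a1 -> 0 <= a2 -> 0 < c -> 2^-1 <= e ->
  exists f : euclid R d.+1 -> R,
    [/\ measurable_fun setT f, (barron_const f <= c%:E)%E &
        \forall k \near \oo, forall g, shallow_nets k a1 a2 a3 g ->
          ((k%:R `^ (- e))%:E <= L2_norm_cube (fun x => f x - g x)%R)%E].
Proof.
move=> a10 a20 c0 e2; have c16 : 0 <= c / 16 by rewrite divr_ge0// ltW.
(* The value c / 16 matches the constant 16 a of [lacunary_barron_class]. *)
pose a : {nonneg R} := NngNum c16; exists (lacunary_fun a); split.
- exact: measurable_lacunary_fun.
- apply: ereal_inf_lbound; exists c => //; split; first exact: ltW.
  exists (lacunary_fun a) => //.
  have -> : c = 16 * a%:num by rewrite /=; field.
  exact: lacunary_barron_class.
- by apply: lacunary_gap_eventually => //=; rewrite divr_gt0.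
Qed.

Theorem theorem2 (R : realType) (d : nat) (d_gt0 : (0 < d)%N) :
  (exists chat : R,
    forall (P Q : probability (euclid R d) R),
      P (unit_cube d) = 1%E -> Q (unit_cube d) = 1%E ->
    forall (c : R), 0 <= c ->
    forall (k : nat), (0 < k)%N ->
    forall f : euclid R d -> R,
      measurable_fun (unit_cube d) f -> (barron_const f <= c%:E)%E ->
    exists2 g : euclid R d -> R, shallow_nets_star k c g &
      (sup_norm2 P Q (fun x => f x - g x)%R
         <= (((chat + 2) * c + 2) * k%:R `^ (- 2^-1))%:E)%E)
  /\
  (forall eps : R, 0 < eps ->
    exists2 C : R, 0 < C &
    forall (a1 a2 a3 c : R), 0 <= a1 -> 0 <= a2 -> 0 <= a3 -> 0 < c ->
    exists f : euclid R d -> R,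
      [/\ measurable_fun (unit_cube d) f,
          (barron_const f <= c%:E)%E &
          \forall k \near \oo,
            ((C * k%:R `^ (- (2^-1 + d%:R^-1 + eps)))%:E
               <= ereal_inf [set L2_norm_cube (fun x => f x - g x)%R
                            | g in shallow_nets k a1 a2 a3])%E]).
Proof.
split.
  have [chat h] := @barron_upper_bound R d d_gt0.
  exists chat => P Q P1 Q1 c c0 k k0 f _ fc.
  have [g gG gerr] := h c c0 k k0 f fc; exists g => //.
  rewrite /sup_norm2 ge_max; apply/andP; split; apply: ess_sup_le_cube => // x cx;
    by rewrite lee_fin; exact: gerr.
case: d d_gt0 => // d _ eps eps0; exists 1 => // a1 a2 a3 c a10 a20 _ c0.
have e2 : 2^-1 <= 2^-1 + d.+1%:R^-1 + eps.
  by rewrite -addrA lerDl addr_ge0 ?invr_ge0 ?ler0n// ltW.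
have [f [mf fc near]] := @barron_lower_bound R d a1 a2 a3 c _ a10 a20 c0 e2.
exists f; split => //; first exact: measurable_funTS.
move: near; apply: filterS => k hk; rewrite mul1r.
by apply: le_ereal_inf_tmp => _ [g gN <-]; exact: hk.
Qed.
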